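(* (One-step solvability and geometric convergence.) Fix a time level $k\in\{1,\dots,n-1\}$ and assume that the preceding iterates $u_{k-1},u_k$ exist and satisfy the a priori bounds $$\|\mathcal L^{1/2}u_j\|\le M_2\quad(j=k-1,k),\qquad \|\mathcal L u_k\|\le M_4,$$ where $M_2,M_4$ are the a priori constants described in the context. Let $$\tau_0=\left(M_7M_6\,\beta_{\max}\right)^{-1},$$ where $$M_5=\frac{T}{2\sqrt{2\alpha_{\min}}}\max_{1\le i\le n}\|f_i\|+M_2,\qquad M_6=\frac{1}{\sqrt{2\alpha_{\min}}}\left(\frac{1}{\alpha_{\min}}\max_{1\le i\le n}\|f_i\|+M_4\right),\qquad M_7=M_2+2M_5 .$$ The number $\tau_0$ depends only on the data of the initial-boundary value problem, through $M_2$, $M_4$, $\alpha_{\min}$, $\beta_{\max}$, $T$ and $\max_i\|f_i\|$, and neither on the time level $k$, nor on the number $n$ of time steps, nor on $\tau$ itself. Then, for every $0<\tau<\tau_0$, the nonlinear equation $$v_{k+1}+\frac{\tau^2}{2}\left(\alpha_k+\frac{\beta_k}{2}\left(\|\mathcal L^{1/2}u_{k+1}\|^2+\|\mathcal L^{1/2}u_{k-1}\|^2\right)\right)\mathcal L v_{k+1}=\frac{\tau^2}{2}f_k+u_k,\qquad u_{k+1}=2v_{k+1}-u_{k-1},$$ possesses exactly one solution $v_{k+1}$, and the iterative process $$v_{k+1}^{(\ell+1)}+\frac{\tau^2}{2}\left(\alpha_k+\frac{\beta_k}{2}\left(\|\mathcal L^{1/2}u_{k+1}^{(\ell)}\|^2+\|\mathcal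 L^{1/2}u_{k-1}\|^2\right)\right)\mathcal L v_{k+1}^{(\ell+1)}=\frac{\tau^2}{2}f_k+u_k,\qquad \ell=0,1,\dots,$$ $$v_{k+1}^{(0)}=\tfrac12(u_k+u_{k-1}),\qquad u_{k+1}^{(\ell)}=2v_{k+1}^{(\ell)}-u_{k-1},$$ converges to it at a geometric rate, with contraction factor $\rho=\tau/\tau_0<1$, i.e. $$\left\|\mathcal L^{1/2}\left(v_{k+1}-v_{k+1}^{(\ell+1)}\right)\right\|\le\rho\left\|\mathcal L^{1/2}\left(v_{k+1}-v_{k+1}^{(\ell)}\right)\right\|,\qquad \ell=0,1,\dots .$$
   Context: $\Omega\subset\mathbb R^2$ is a bounded convex domain, $(\cdot,\cdot)$ and $\|\cdot\|$ are the inner product and norm of $L^2(\Omega)$, and $T>0$. The problem is the Kirchhoff-type equation $u_{tt}-\left(\alpha(t)+\beta(t)\int_\Omega|\nabla u|^2\,dx\,dy\right)\Delta u=f$ in $\Omega\times[0,T]$ with $u(0)=u_0$, $\partial_tu(0)=v_0$, $u(t)|_{\partial\Omega}=0$. Here $\alpha,\beta$ are real-valued and continuously differentiable on $[0,T]$, $\alpha_{\min}=\min_{[0,T]}\alpha>0$, $\min_{[0,T]}\beta>0$, $\beta_{\max}=\max_{[0,T]}\beta$, and $f\in C([0,T];L^2(\Omega))$. $\mathcal L$ is the Friedrichs extension of $-\Delta$ with domain $\{u\in C^2(\overline\Omega):u|_{\partial\Omega}=0\}$, i.e. the unique self-adjoint positive definite operator associated with the form $a(u,v)=(\nabla u,\nabla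 v)$ on $H^1_0(\Omega)$; $D(\mathcal L^{1/2})=H_0^1(\Omega)$, and powers of $\mathcal L$ are defined by the spectral calculus. For an integer $n>1$ put $\tau=T/n$, $t_k=k\tau$, $\alpha_k=\alpha(t_k)$, $\beta_k=\beta(t_k)$, $f_k=f(t_k)$. The time-discrete scheme is $$\frac{u_{k+1}-2u_k+u_{k-1}}{\tau^2}+\frac12\left(\alpha_k+\frac{\beta_k}{2}\left(\|\mathcal L^{1/2}u_{k+1}\|^2+\|\mathcal L^{1/2}u_{k-1}\|^2\right)\right)(\mathcal Lu_{k+1}+\mathcal Lu_{k-1})=f_k,\quad k=1,\dots,n-1,$$ with $u_0=u(0)$, $u_1=u_0+\tau v_0+\frac{\tau^2}{2}w_0$, $w_0=f_0-\left(\alpha_0+\beta_0\|\mathcal L^{1/2}u_0\|^2\right)\mathcal Lu_0$. The nonlinear equation in the claim is this scheme rewritten for $v_{k+1}=\frac12(u_{k+1}+u_{k-1})$. The constants $M_2$ and $M_4$ are those of the following a priori bounds for solution sequences of the scheme. If $u_0,v_0,w_0\in D(\mathcal L^{1/2})$, then $\|\mathcal L^{1/2}u_k\|\le M_2$ for $k=1,\dots,n$, with a positive constant $M_2$ depending only on $u_0,v_0,w_0$, $\alpha$, $\beta$, $T$ and $\max_{0\le t\le T}\|f(t)\|$, hence independent of $\tau$. If $u_0\in D(\mathcal L^2)$, $v_0\in D(\mathcal L)$, $f\in C([0,T];D(\mathcal L^{1/2}))$ and $f_0\in D(\mathcal L)$, then there is $\overline T\in(0,T]$ such that $\|\mathcal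 Lu_k\|\le M_4$ for $1\le k\le[\overline T/\tau]$, with a positive constant $M_4$ determined by the data and the value of $\overline T$, uniformly in $k$ and $\tau$.
   Formalization: Since max over 1≤i≤n of ‖f_i‖ varies with n, τ_0 literally depends on n; its independence of n is proved as: one positive threshold, fixed before n, lies below τ_0 for every n>1. Solvability and the rate use τ_0 as written. *)

(* Defs.v *)
From HB Require Import structures.
From mathcomp Require Import all_boot all_order all_algebra.
From mathcomp Require Import all_classical all_reals all_analysis.

Set Implicit Arguments.
Unset Strict Implicit.
Unset Printing Implicit Defensive.

Import Order.TTheory GRing.Theory Num.Theory.
Import numFieldNormedType.Exports.

Local Open Scope classical_set_scope.
Local Open Scope ring_scope.

Lemma open_measurable_plane (R : realType) (A : set (R * R)) :
  open A -> measurable (A : set (measurableTypeR R * measurableTypeR R)).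
Proof.
move=> oA.
have rat_btw (x y : R) : x < y -> exists a : rat, x < ratr a < y.
  by move=> /rat_in_itvoo[a]; rewrite in_itv /= => ?; exists a.
pose box (q : (rat * rat) * (rat * rat)) : set (R * R) :=
  `]ratr q.1.1, ratr q.1.2[ `*` `]ratr q.2.1, ratr q.2.2[.
have -> : A = \bigcup_(q in [set q | box q `<=` A]) box q.
  apply/seteqP; split => [[x y] Axy|z [q /= + qz]]; last exact.
  have /nbhs_ballP [e /= e0 eA] : nbhs (x, y) A by exact: open_nbhs_nbhs.
  have /rat_btw[a /andP[a1 a2]] : x - e < x by rewrite ltrBlDr ltrDl.
  have /rat_btw[b /andP[b1 b2]] : x < x + e by rewrite ltrDl.
  have /rat_btw[c /andP[c1 c2]] : y - e < y by rewrite ltrBlDr ltrDl.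
  have /rat_btw[d /andP[d1 d2]] : y < y + e by rewrite ltrDl.
  exists ((a, b), (c, d)); last first.
    by rewrite /box; split; rewrite /= in_itv /= ?a2 ?b1 ?c2 ?d1.
  move=> [u v] []; rewrite /= !in_itv /= => /andP[u1 u2] /andP[v1 v2].
  apply: eA; split; rewrite /ball /= ltr_distlC.
    by rewrite (lt_trans a1) //= (lt_trans u2).
  by rewrite (lt_trans c1) //= (lt_trans v2).
rewrite bigcup_mkcond; apply: countable_bigcupT_measurable => [|q].
  exact: countableP.
by case: ifP => // _; apply: measurableX; exact: measurable_itv.
Qed.

Record bounded_convex_domain (R : realType) := BoundedConvexDomain {
  dom_set :> set (R * R);
  dom_open : open dom_set;
  dom_nonempty : dom_set !=set0;
  dom_bounded : bounded_set dom_set;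
  dom_convex : convex_set (dom_set : set (convex_lmodType (R^o * R^o)%type)) }.

Section L2.
Context (R : realType) (Om : bounded_convex_domain R).

(* Lebesgue measure on the plane, restricted to the domain. *)
Definition area : {measure set (measurableTypeR R * measurableTypeR R) -> \bar R} :=
  mrestr (lebesgue_measure \x lebesgue_measure)%E
    (open_measurable_plane (@dom_open _ Om)).

(* Square-integrable functions.  The library has no vector space structure on
   the a.e. quotient, so an element of L^2(Omega) is given by a representative
   and equality in L^2(Omega) is [u =L2 v] below. *)
Definition L2 := LfunType area (lee1n 2).

Definition L2eq (u v : L2) : Prop := u = v %[ae area].

Definition L2norm (u : L2) : R := fine ('N[area]_2%:E [EFin \o u]).

Definition L2inner (u v : L2) : R := \int[area]_z (u z * v z).

Definition L2continuous (T : R) (f : R -> L2) : Prop :=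
  forall t, t \in `[0, T] ->
    L2norm (f s - f t) @[s --> within `[0, T] (nbhs t)] --> (0 : R).

End L2.

Notation "u =L2 v" := (L2eq u v) (at level 70, no associativity).

Section laplacian.
Context (R : realType) (Om : bounded_convex_domain R).
Implicit Types u v w g : L2 Om.

Definition partial (i : bool) (phi : R * R -> R) : R * R -> R :=
  fun z => 'D_(if i then (0, 1) else (1, 0)) phi z.

Definition smooth (phi : R * R -> R) : Prop :=
  forall (s : seq bool) (z : R * R), differentiable (foldr partial phi s) z.

Definition test_function (phi : R * R -> R) : Prop :=
  [/\ smooth phi, compact (closure [set z | phi z != 0])
    & closure [set z | phi z != 0] `<=` Om].

Definition L2_limit (phi : nat -> R * R -> R) u : Prop :=
  'N[area Om]_2%:E [EFin \o (phi m \- u)%R]%E @[m --> \oo] --> (0 : \bar R).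

(* u is in H^1_0(Omega), the closure of the test functions in the H^1 norm,
   and (ux, uy) is its weak gradient. *)
Definition H10_gradient u ux uy : Prop :=
  exists phi : nat -> R * R -> R,
    [/\ forall m, test_function (phi m), L2_limit phi u,
        L2_limit (partial false \o phi) ux & L2_limit (partial true \o phi) uy].

(* The operator associated with the form a(u,v) = (grad u, grad v) on
   H^1_0(Omega), given by its graph. *)
Definition laplacian_graph u g : Prop :=
  exists ux uy, H10_gradient u ux uy /\
    forall v vx vy, H10_gradient v vx vy ->
      L2inner ux vx + L2inner uy vy = L2inner g v.

Definition in_DL u : Prop := exists g, laplacian_graph u g.

(* Junk value 0 outside D(L). *)
Definition opL u : L2 Om := xget 0 [set g | laplacian_graph u g].

(* [spectral_int m phi u w] means that u lies in the domain of
   int phi(lambda) dE_lambda and is sent to w, where [m u] is the measure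
   (E_lambda u, u).  Off the diagonal, (E_lambda u, v) is recovered by
   polarization. *)
Definition spectral_int (m : L2 Om -> {measure set (measurableTypeR R) -> \bar R})
    (phi : R -> R) u w : Prop :=
  let dom v := (\int[m v]_l ((phi l) ^+ 2)%:E < +oo)%E in
  dom u /\ forall v, dom v ->
    L2inner w v =
      (\int[m (u + v)%R]_l phi l - \int[m (u - v)%R]_l phi l) / 4.

(* The spectral resolution of L: a projection-valued measure E on the Borel
   sets of the line with L = int lambda dE_lambda.  It exists and is unique by
   the spectral theorem.  Countable additivity of E is that of the measures
   [spec_meas u]. *)
Record spectral_resolution := SpectralResolution {
  spec_proj : set (measurableTypeR R) -> L2 Om -> L2 Om;
  spec_meas : L2 Om -> {measure set (measurableTypeR R) -> \bar R};
  spec_linear : forall A a u v, measurable A ->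
    spec_proj A (a *: u + v) =L2 a *: spec_proj A u + spec_proj A v;
  spec_sym : forall A u v, measurable A ->
    L2inner (spec_proj A u) v = L2inner u (spec_proj A v);
  spec_setT : forall u, spec_proj setT u =L2 u;
  spec_setI : forall A B u, measurable A -> measurable B ->
    spec_proj (A `&` B) u =L2 spec_proj A (spec_proj B u);
  spec_measE : forall u A, measurable A ->
    spec_meas u A = (L2inner (spec_proj A u) u)%:E;
  spec_opL : forall u w,
    laplacian_graph u w <-> spectral_int spec_meas id u w }.

Variable E : spectral_resolution.

(* L^s = int lambda^s dE_lambda; the values of [powR] at lambda <= 0 play no
   role since L is positive definite. *)
Definition powL_graph (s : R) u w : Prop :=
  spectral_int (spec_meas E) (fun l => l `^ s) u w.

Definition in_DpowL s u : Prop := exists w, powL_graph s u w.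

(* Junk value 0 outside D(L^s). *)
Definition powL s u : L2 Om := xget 0 [set w | powL_graph s u w].

Definition in_Dhalf u : Prop := in_DpowL 2^-1 u.

Definition energy_norm u : R := L2norm (powL 2^-1 u).

End laplacian.

Section scheme.
Context (R : realType) (Om : bounded_convex_domain R).
Variables (E : spectral_resolution Om) (T : R) (alpha beta : R -> R).
Variables (f : R -> L2 Om) (u0 v0 : L2 Om).
Implicit Types (n k m : nat) (u : nat -> L2 Om).

Definition tstep n : R := T / n%:R.

Definition tgrid n k : R := k%:R * tstep n.

Definition min_on (h : R -> R) : R := inf [set h t | t in `[0, T]].

Definition max_on (h : R -> R) : R := sup [set h t | t in `[0, T]].

(* One-sided difference quotients at 0 and T. *)
Definition C1_on (h : R -> R) : Prop :=
  exists dh : R -> R, {within `[0, T], continuous dh} /\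
    forall t, t \in `[0, T] ->
      (h s - h t) / (s - t) @[s --> within (`[0, T] `\ t) (nbhs t)] --> dh t.

Definition w0 : L2 Om :=
  f 0 - (alpha 0 + beta 0 * energy_norm E u0 ^+ 2) *: opL u0.

(* alpha_k + beta_k / 2 (|L^(1/2) x|^2 + |L^(1/2) y|^2) *)
Definition kcoef n k (x y : L2 Om) : R :=
  alpha (tgrid n k) +
  beta (tgrid n k) / 2 * (energy_norm E x ^+ 2 + energy_norm E y ^+ 2).

Definition scheme_level n k u : Prop :=
  [/\ in_DL (u k.+1), in_DL (u k.-1) &
    (tstep n ^- 2) *: (u k.+1 - 2 *: u k + u k.-1)
    + (2^-1 * kcoef n k (u k.+1) (u k.-1)) *: (opL (u k.+1) + opL (u k.-1))
    =L2 f (tgrid n k)].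

(* u_0, ..., u_m are iterates of the scheme with n time steps; the terms of u
   of index larger than m are irrelevant. *)
Definition scheme_upto n m u : Prop :=
  [/\ in_DL u0, u 0%N =L2 u0,
      u 1%N =L2 u0 + tstep n *: v0 + (tstep n ^+ 2 / 2) *: w0
    & forall k, (1 <= k < m)%N -> scheme_level n k u].

Definition Dhalf_bound (x : L2 Om) (M : R) : Prop :=
  in_Dhalf E x /\ energy_norm E x <= M.

Definition DL_bound (x : L2 Om) (M : R) : Prop :=
  in_DL x /\ L2norm (opL x) <= M.

Definition apriori_M2 (M2 : R) : Prop :=
  0 < M2 /\
  (in_Dhalf E u0 -> in_Dhalf E v0 -> in_Dhalf E w0 ->
   forall n u, (1 < n)%N -> scheme_upto n n u ->
   forall k, (1 <= k <= n)%N -> Dhalf_bound (u k) M2).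

Definition apriori_M4 (M4 : R) : Prop :=
  0 < M4 /\
  (in_DpowL E 2 u0 -> in_DL v0 ->
   (forall t, t \in `[0, T] -> in_Dhalf E (f t)) ->
   L2continuous T f -> L2continuous T (fun t => powL E 2^-1 (f t)) ->
   in_DL (f 0) ->
   exists2 Tbar : R, 0 < Tbar <= T &
   forall n u, (1 < n)%N -> scheme_upto n n u ->
   forall k, (1 <= k <= Num.truncn (Tbar / tstep n))%N -> DL_bound (u k) M4).

Definition fmax n : R := \big[Num.max/0]_(1 <= i < n.+1) L2norm (f (tgrid n i)).

Definition M5 M2 n : R := T / (2 * Num.sqrt (2 * min_on alpha)) * fmax n + M2.

Definition M6 M4 n : R :=
  (Num.sqrt (2 * min_on alpha))^-1 * ((min_on alpha)^-1 * fmax n + M4).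

Definition M7 M2 n : R := M2 + 2 * M5 M2 n.

Definition tau0 M2 M4 n : R := (M7 M2 n * M6 M4 n * max_on beta)^-1.

(* v + tau^2/2 (alpha_k + beta_k/2 (|L^(1/2)(2 x - um)|^2 + |L^(1/2) um|^2)) L v
   = tau^2/2 f_k + uk, with uk, um in the roles of u_k, u_(k-1). *)
Definition level_eq n k (uk um x v : L2 Om) : Prop :=
  in_DL v /\
  v + (tstep n ^+ 2 / 2 * kcoef n k (2 *: x - um) um) *: opL v
  =L2 (tstep n ^+ 2 / 2) *: f (tgrid n k) + uk.

Definition nonlinear_solution n k (uk um v : L2 Om) : Prop :=
  level_eq n k uk um v v.

Definition iteration n k (uk um : L2 Om) (vl : nat -> L2 Om) : Prop :=
  vl 0%N =L2 2^-1 *: (uk + um) /\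
  forall l, level_eq n k uk um (vl l) (vl l.+1).

End scheme.

(* Main.v *)
Require Import Defs.
From HB Require Import structures.
From mathcomp Require Import all_boot all_order all_algebra.
From mathcomp Require Import all_classical all_reals all_analysis.
From mathcomp Require Import measurable_realfun ring lra.

Import Order.TTheory GRing.Theory Num.Theory.
Import numFieldNormedType.Exports.

Local Open Scope classical_set_scope.
Local Open Scope ring_scope.

Set Implicit Arguments.
Unset Strict Implicit.
Unset Printing Implicit Defensive.

(** The unknown of the implicit equation enters the operator only through the
    number [c(x)], the coefficient computed from a trial vector [x]. Once that
    number is frozen the equation reads [v + c L v = g] with
    [g = tau^2/2 f_k + u_k], and the resolvent of the positive operator [L]
    solves it. Three estimates on [v + c L v = g] follow by expanding squares:
    [4 c |L^(1/2) v|^2 <= |g|^2] and [c |L v| <= |g|] ([resolvent_en],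
    [resolvent_op]), while for data in the domain of [L] the resolvent contracts
    both [|L^(1/2) .|] and [|L .|] ([resolvent_regular]). Since
    [c >= tau^2 alpha_min / 2], they bound every trial solution by
    [|L^(1/2) v| <= M5] and [|L v| <= (2 alpha_min)^(1/2) M6].

    Two frozen problems with coefficients [c] and [c'] have a difference [z]
    with [z + c L z = (c' - c) L v'], so that
    [|L^(1/2) (v - v')| <= |c - c'| M6 / tau]; and [c] is a quadratic expression
    in [L^(1/2) x], so that
    [|c(x) - c(x')| <= tau^2 beta_max M7 |L^(1/2) (x - x')|].
    The product is the factor [tau M7 M6 beta_max = tau / tau0]
    ([step_contraction]). It yields uniqueness and the geometric rate.
    Existence is a fixed point problem on the real line: the map [s |-> c(v_s)],
    with [v_s] the solution for the frozen coefficient [s], is a contraction of a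
    half line ([step_exists]).

    What this uses about [L] is collected in [energy_operator]: a symmetric graph
    with everywhere defined resolvents, and an energy seminorm with
    [|L^(1/2) u|^2 = (L u, u)]. These properties come from the spectral measure.
    The map sending a step function [s] to [s(L) u] is an isometry from L2(m_u)
    ([step_op_sqr]), and L2 is complete ([Lfun2_complete]), so it extends to every
    square integrable [phi] ([calc], [calc_exists]); composition ([calc_comp])
    and the matrix elements by polarization ([calc_polar], [calc_of_polar]) pass to
    the limit. As the form of the Laplacian is nonnegative, the spectral measure
    does not charge the negative half line ([smeas_ae_ge0]); hence
    [x |-> (1 + c x)^-1] gives the resolvent and the square root of [x] gives
    the energy.

    The bound from below on [tau0] holds because [t |-> |f(t)|] is continuous
    on the compact interval [[0, T]], which bounds the maximum of [|f_i|]
    independently of [n] ([tau0_ge]). *)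

(** * Square integrable functions *)

Section square_integrable.
Context d (T : measurableType d) (R : realType).
Variable mu : {measure set T -> \bar R}.
Implicit Types f g : T -> R.

Lemma Lfun2_measurable f : f \in Lfun mu 2%:E -> measurable_fun setT f.
Proof. by move=> /andP[/set_mem]. Qed.

Lemma Lfun2Z a f : f \in Lfun mu 2%:E -> (fun x => a * f x) \in Lfun mu 2%:E.
Proof.
move=> f2; have [L0 LD] := @Lfun_submod_closed _ T R mu 2%:E (lee1n 2).
have -> : (fun x => a * f x) = a *: f + 0 by apply/funext => x; rewrite addr0.
exact: LD.
Qed.

Lemma Lfun2D f g : f \in Lfun mu 2%:E -> g \in Lfun mu 2%:E ->
  (fun x => f x + g x) \in Lfun mu 2%:E.
Proof.
move=> f2 g2; have [_ LD] := @Lfun_submod_closed _ T R mu 2%:E (lee1n 2).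
have -> : (fun x => f x + g x) = 1 *: f + g.
  by apply/funext => x; rewrite scale1r.
exact: LD.
Qed.

Lemma Lfun2B f g : f \in Lfun mu 2%:E -> g \in Lfun mu 2%:E ->
  (fun x => f x - g x) \in Lfun mu 2%:E.
Proof.
move=> f2 g2; have -> : (fun x => f x - g x) = (fun x => f x + (-1) * g x).
  by apply/funext => x; rewrite mulN1r.
by apply: Lfun2D => //; exact: Lfun2Z.
Qed.

Lemma Lfun2P f : measurable_fun setT f ->
  (\int[mu]_x ((f x) ^+ 2)%:E < +oo)%E -> f \in Lfun mu 2%:E.
Proof.
move=> mf f2; rewrite inE; apply/andP; split; rewrite inE//=.
rewrite /finite_norm unlock; apply: poweR_lty.
under eq_integral => x _ do
  rewrite /= powR_mulrn ?normr_ge0// real_normK ?num_real//.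
exact: f2.
Qed.

Lemma Lfun2_mul f g : f \in Lfun mu 2%:E -> g \in Lfun mu 2%:E ->
  mu.-integrable setT (EFin \o (fun x => f x * g x)).
Proof. by move=> f2 g2; apply/Lfun1_integrable; exact: Lfun2_mul_Lfun1. Qed.

Lemma Lfun2_sqr_EFin f : f \in Lfun mu 2%:E ->
  (\int[mu]_x ((f x) ^+ 2)%:E)%E = (\int[mu]_x (f x) ^+ 2)%:E.
Proof.
move=> /Lfun2_integrable_sqr f2; rewrite /Rintegral fineK//.
exact: integrable_fin_num f2.
Qed.

Lemma Lfun2_sqr_lty f : f \in Lfun mu 2%:E ->
  (\int[mu]_x ((f x) ^+ 2)%:E < +oo)%E.
Proof. by move=> f2; rewrite Lfun2_sqr_EFin// ltry. Qed.

Lemma RintegralDl f g h a : f \in Lfun mu 2%:E -> g \in Lfun mu 2%:E ->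
  h \in Lfun mu 2%:E ->
  \int[mu]_x ((a * f x + g x) * h x) =
  a * \int[mu]_x (f x * h x) + \int[mu]_x (g x * h x).
Proof.
move=> f2 g2 h2; rewrite -RintegralZl//; last exact: Lfun2_mul.
rewrite -RintegralD//; last exact: Lfun2_mul.
  by apply: eq_Rintegral => x _; rewrite mulrDl mulrA.
have := integrableZl measurableT a (Lfun2_mul f2 h2).
by apply: eq_integrable => // x _; rewrite /= EFinM.
Qed.

Lemma Lfun2_le f g : measurable_fun setT f -> g \in Lfun mu 2%:E ->
  (forall x, `|f x| <= `|g x|) -> f \in Lfun mu 2%:E.
Proof.
move=> mf g2 fg; apply: Lfun2P => //; apply: le_lt_trans (Lfun2_sqr_lty g2).
apply: ge0_le_integral => //.
- by move=> x _; rewrite lee_fin sqr_ge0.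
- by apply/measurable_EFinP; exact: measurable_funX.
- apply/measurable_EFinP; apply: measurable_funX; exact: Lfun2_measurable g2.
- move=> x _; rewrite lee_fin -(real_normK (num_real (f x))).
  by rewrite -(real_normK (num_real (g x))) lerXn2r ?nnegrE.
Qed.

(** Fatou's lemma for the squares *)
Lemma Lfun2_cvg_bound (f_ : nat -> T -> R) f (C : R) :
  (forall n, f_ n \in Lfun mu 2%:E) -> (forall x, f_ n x @[n --> \oo] --> f x) ->
  (\forall n \near \oo, \int[mu]_x (f_ n x) ^+ 2 <= C) ->
  f \in Lfun mu 2%:E /\ \int[mu]_x (f x) ^+ 2 <= C.
Proof.
move=> f_2 f_f fC.
have mf : measurable_fun setT f.
  apply: (@measurable_fun_cvg _ _ _ _ f_) => // n.
  exact: Lfun2_measurable.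
have leC : (\int[mu]_x ((f x) ^+ 2)%:E <= C%:E)%E.
  rewrite (_ : (fun x => ((f x) ^+ 2)%:E) =
     (fun x => limn_einf (fun n => ((f_ n x) ^+ 2)%:E))); last first.
    apply/funext => x; apply/esym.
    have h : ((f_ n x) ^+ 2)%:E @[n --> \oo] --> ((f x) ^+ 2)%:E.
      by apply: cvg_EFin; [exact: nearW|apply: cvgM; exact: f_f].
    by rewrite (cvg_limn_einf_sup h).
  apply: le_trans (fatou mu measurableT _ _) _.
  - move=> n; apply/measurable_EFinP; apply: measurable_funX.
    exact: Lfun2_measurable.
  - by move=> n x _; rewrite lee_fin sqr_ge0.
  - rewrite limn_einf_lim; apply: lime_le; first exact: is_cvg_einfs.
    near=> n; apply: le_trans (ereal_inf_lbound _) _; first by exists n => /=.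
    by rewrite Lfun2_sqr_EFin// lee_fin; near: n.
have f2 : f \in Lfun mu 2%:E.
  by apply: Lfun2P => //; apply: le_lt_trans leC _; rewrite ltry.
by split=> //; rewrite -lee_fin -Lfun2_sqr_EFin.
Unshelve. all: by end_near. Qed.

Lemma Rintegral_dominated_cvg (f_ : nat -> T -> R) f g :
  (forall n, measurable_fun setT (f_ n)) ->
  (forall x, f_ n x @[n --> \oo] --> f x) ->
  mu.-integrable setT (EFin \o g) -> (forall n x, `|f_ n x| <= g x) ->
  \int[mu]_x f_ n x @[n --> \oo] --> \int[mu]_x f x.
Proof.
move=> mf_ f_f ig f_g.
have mf : measurable_fun setT f.
  exact: (@measurable_fun_cvg _ _ _ _ f_).
have [] := @dominated_convergence _ _ _ mu setT measurableT
  (fun n x => (f_ n x)%:E) (EFin \o f) (EFin \o g).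
- by move=> n; exact/measurable_EFinP.
- exact/measurable_EFinP.
- by apply/nearW => x _; apply: cvg_EFin; [exact: nearW|exact: f_f].
- exact: ig.
- by apply/nearW => x n _; rewrite lee_fin.
move=> i_f _ h.
apply: (@fine_cvg _ _ _ _ (fun n => \int[mu]_x (f_ n x)%:E)%E).
rewrite /Rintegral fineK//; exact: integrable_fin_num i_f.
Qed.

Lemma ae_eq_Rintegral f g : measurable_fun setT f -> measurable_fun setT g ->
  {ae mu, forall x, f x = g x} -> \int[mu]_x f x = \int[mu]_x g x.
Proof.
move=> mf mg fg; congr fine; apply: ae_eq_integral => //.
- exact/measurable_EFinP.
- exact/measurable_EFinP.
- by apply: filterS fg => x /= -> _.
Qed.

Lemma Lfun2_dominated_dist (f_ : nat -> T -> R) f g :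
  (forall n, measurable_fun setT (f_ n)) ->
  (forall n x, `|f_ n x| <= `|f x|) ->
  (forall x, f_ n x @[n --> \oo] --> f x) ->
  f \in Lfun mu 2%:E -> g \in Lfun mu 2%:E ->
  \int[mu]_x (f_ n x - g x) ^+ 2 @[n --> \oo] -->
  \int[mu]_x (f x - g x) ^+ 2.
Proof.
move=> mf_ f_le f_f f2 g2.
have abs2 k : k \in Lfun mu 2%:E -> (fun x => `|k x|) \in Lfun mu 2%:E.
  move=> k2; apply: (Lfun2_le _ k2); last by move=> x; rewrite normr_id.
  by apply: measurableT_comp => //; exact: Lfun2_measurable k2.
have G2 := Lfun2D (abs2 _ f2) (abs2 _ g2).
apply: (Rintegral_dominated_cvg (g := fun x => (`|f x| + `|g x|) ^+ 2)).
- move=> n; apply: measurable_funX; apply: measurable_funB => //.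
  exact: Lfun2_measurable g2.
- by move=> x; apply: cvgM; apply: cvgB => //; exact: cvg_cst.
- exact: Lfun2_integrable_sqr G2.
- move=> n x; rewrite normrX lerXn2r ?nnegrE ?addr_ge0//.
  by apply: le_trans (ler_normB _ _) _; rewrite lerD2r.
Qed.

Lemma Rintegral_sqrB_le f g :
  f \in Lfun mu 2%:E -> g \in Lfun mu 2%:E ->
  \int[mu]_x (f x - g x) ^+ 2 <=
  2 * \int[mu]_x (f x) ^+ 2 + 2 * \int[mu]_x (g x) ^+ 2.
Proof.
move=> f2 g2; have if2 := Lfun2_integrable_sqr f2.
have ig2 := Lfun2_integrable_sqr g2.
have i2 (k : T -> R) : mu.-integrable setT (EFin \o k) ->
    mu.-integrable setT (EFin \o (fun x => 2 * k x)).
  move=> ik; have := integrableZl measurableT 2 ik.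
  by apply: eq_integrable => // x _; rewrite /= EFinM.
rewrite -!RintegralZl// -RintegralD//; [|exact: i2|exact: i2].
apply: le_Rintegral => //.
- exact: Lfun2_integrable_sqr (Lfun2B f2 g2).
- have := integrableD measurableT (i2 _ if2) (i2 _ ig2).
  by apply: eq_integrable => // x _; rewrite /= EFinD.
- by move=> x _; have := sqr_ge0 (f x + g x); lra.
Qed.

End square_integrable.

(** * Completeness of L2 *)

Lemma cvg_of_weighted_sqr (R : realType) (v : nat -> R) (M : R) :
  (forall k, 4 ^+ k * (v k.+1 - v k) ^+ 2 <= M) -> cvgn v.
Proof.
move=> vM.
have dv k : `|v k.+1 - v k| <= Num.sqrt M * 2^-1 ^+ k.
  rewrite exprVn ler_pdivlMr ?exprn_gt0// -[leLHS]ger0_norm ?mulr_ge0//.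
  rewrite -sqrtr_sqr ler_wsqrtr// exprMn real_normK ?num_real// mulrC.
  by rewrite exprAC -natrX; exact: vM.
have -> : v = (fun n => v 0%N + series (telescope v) n).
  by apply/funext => n; rewrite -eq_sum_telescope.
apply: is_cvgD; first exact: is_cvg_cst.
apply: normed_cvg; apply: (@series_le_cvg _ _ (geometric (Num.sqrt M) 2^-1)).
- by move=> n; exact: normr_ge0.
- by move=> n; rewrite mulr_ge0 ?sqrtr_ge0 ?exprn_ge0.
- exact: dv.
- by apply: is_cvg_geometric_series; rewrite ger0_norm ?invr_ge0// invf_lt1// ltr1n.
Qed.

Section riesz_fischer.
Context d (T : measurableType d) (R : realType).
Variable mu : {measure set T -> \bar R}.

(** The weights [4^k] leave the series of the [4^k |v_(k+1) - v_k|^2] integrable,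
    so that it is finite almost everywhere; there the increments are bounded
    by a geometric sequence. *)
Lemma fast_Lfun2_cvg_ae (v : nat -> T -> R) :
  (forall k, v k \in Lfun mu 2%:E) ->
  (forall k, \int[mu]_x (v k.+1 x - v k x) ^+ 2 <= 8^-1 ^+ k) ->
  {ae mu, forall x, cvgn (v ^~ x)}.
Proof.
move=> v2 dv.
have dv2 k : (fun x => v k.+1 x - v k x) \in Lfun mu 2%:E by exact: Lfun2B.
pose h k x := (4 ^+ k * (v k.+1 x - v k x) ^+ 2)%:E.
have h0 k x : (0 <= h k x)%E by rewrite lee_fin mulr_ge0 ?sqr_ge0 ?exprn_ge0.
have mh k : measurable_fun setT (h k).
  apply/measurable_EFinP; apply: measurable_funM => //.
  by apply: measurable_funX; exact: Lfun2_measurable (dv2 k).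
pose H x := (\sum_(0 <= k <oo) h k x)%E.
have mH : measurable_fun setT H by exact: ge0_emeasurable_sum.
have H0 x : (0 <= H x)%E by exact: nneseries_ge0.
have intH : mu.-integrable setT H.
  apply/integrableP; split=> //.
  under eq_integral => x _ do rewrite gee0_abs//.
  rewrite integral_nneseries//.
  apply: (@le_lt_trans _ _ 2%:E); last by rewrite ltry.
  apply: lime_le; first by apply: is_cvg_nneseries => k _ _; exact: integral_ge0.
  apply: nearW => n.
  apply: (@le_trans _ _ (\sum_(0 <= k < n) (2^-1 ^+ k)%:E)%E).
    apply: lee_sum => k _; rewrite /h.
    under eq_integral do rewrite EFinM.
    rewrite ge0_integralZl//=.
    - rewrite Lfun2_sqr_EFin// -EFinM lee_fin.
      have -> : 2^-1 ^+ k = 4 ^+ k * 8^-1 ^+ k :> R.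
        by rewrite -exprMn; congr (_ ^+ k); field.
      by rewrite ler_wpM2l// exprn_ge0.
    - apply/measurable_EFinP; apply: measurable_funX.
      exact: Lfun2_measurable (dv2 k).
    - by move=> x _; rewrite lee_fin sqr_ge0.
  rewrite sumEFin. rewrite lee_fin.
  have -> : \sum_(0 <= k < n) 2^-1 ^+ k = series (geometric 1 (2^-1 : R)) n.
    by apply: eq_bigr => k _; rewrite /= mul1r.
  rewrite geometric_seriesE; last by rewrite lt_eqF// invf_lt1// ltr1n.
  rewrite /= mul1r (_ : 1 - 2^-1 = 2^-1 :> R); last by field.
  by rewrite invrK ler_piMl// gerBl exprn_ge0.
apply: filterS (integrable_ae measurableT intH) => x /(_ I) Hfin.
apply: (@cvg_of_weighted_sqr _ _ (fine (H x))) => k.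
rewrite -lee_fin fineK//; apply: le_trans (nneseries_lim_ge k.+1 _) => //.
by rewrite big_nat_recr//= leeDr// sume_ge0.
Qed.

(** The limit is obtained along a fast subsequence, which converges almost
    everywhere, and Fatou's lemma bounds its distance to the sequence. *)
Lemma Lfun2_complete (u : nat -> T -> R) :
  (forall k, u k \in Lfun mu 2%:E) ->
  (forall e, 0 < e -> exists N, forall m n, (N <= m)%N -> (N <= n)%N ->
     \int[mu]_x (u m x - u n x) ^+ 2 <= e) ->
  exists2 w, w \in Lfun mu 2%:E & forall e, 0 < e ->
    exists N, forall n, (N <= n)%N -> \int[mu]_x (w x - u n x) ^+ 2 <= e.
Proof.
move=> u2 cu.
have e8 k : 0 < 8^-1 ^+ k :> R by rewrite exprn_gt0.
have /choice[N HN] k := cu _ (e8 k).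
(* Past this rank [u] varies by at most [8^-i] in mean square, for all [i <= k]. *)
pose s k := (\max_(i < k.+1) N i)%N.
have Ns i k : (i <= k)%N -> (N i <= s k)%N.
  by rewrite -ltnS => ik; exact: (leq_bigmax (Ordinal ik)).
pose v k := u (s k).
have v2 k : v k \in Lfun mu 2%:E by exact: u2.
have vae : {ae mu, forall x, cvgn (v ^~ x)}.
  by apply: fast_Lfun2_cvg_ae => // k; apply: HN; exact: Ns.
have [Z [mZ Z0 vZ]] := vae.
pose G := ~` Z.
have mG : measurable G by exact: measurableC.
pose v' k x := v k x * \1_G x.
have v'v k x : G x -> v' k x = v k x.
  by move=> Gx; rewrite /v' indicE mem_set// mulr1.
have v'2 k : v' k \in Lfun mu 2%:E.
  apply: Lfun2_le (v2 k) _.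
    by apply: measurable_funM; [exact: Lfun2_measurable|exact: measurable_indic].
  move=> x; rewrite /v' indicE normrM; case: (x \in G) => /=.
    by rewrite normr1 mulr1.
  by rewrite normr0 mulr0.
pose w x := limn (v' ^~ x).
have v'w x : v' n x @[n --> \oo] --> w x.
  have [Zx|Gx] := pselect (Z x).
    have v'0 : v' ^~ x = fun=> 0.
      by apply/funext => k; rewrite /v' indicE memNset ?mulr0//= => Gx.
    by rewrite /w v'0 lim_cst//; exact: cvg_cst.
  have v'x : v' ^~ x = v ^~ x by apply/funext => k; exact: v'v.
  by rewrite /w v'x; apply: contrapT => ncv; apply: Gx; exact: vZ.
have wu j n : (N j <= n)%N ->
    (fun x => w x - u n x) \in Lfun mu 2%:E /\
    \int[mu]_x (w x - u n x) ^+ 2 <= 8^-1 ^+ j.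
  move=> jn; apply: (@Lfun2_cvg_bound _ _ _ _ (fun k x => v' k x - u n x)).
  - by move=> k; apply: Lfun2B.
  - by move=> x; apply: cvgB => //; exact: cvg_cst.
  - near=> k.
    rewrite (_ : \int[mu]_x _ = \int[mu]_x (v k x - u n x) ^+ 2).
      by apply: HN => //; apply: Ns; near: k; exists j.
    apply: ae_eq_Rintegral.
    + by apply: measurable_funX; apply: Lfun2_measurable; apply: Lfun2B.
    + by apply: measurable_funX; apply: Lfun2_measurable; apply: Lfun2B.
    + exists Z; split=> // x /= nx; apply: contrapT => Gx.
      by apply: nx; rewrite v'v.
have [w2 _] := wu 0%N (N 0%N) (leqnn _).
exists w.
  rewrite (_ : w = (fun x => (w x - u (N 0%N) x) + u (N 0%N) x)).
    by apply: Lfun2D.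
  by apply/funext => x; rewrite subrK.
move=> e e0.
have [j je] : exists j, 8^-1 ^+ j <= e :> R.
  have /cvgr0Pnorm_le/(_ _ e0)[j _ /(_ j (leqnn _))] :
      8^-1 ^+ n @[n --> \oo] --> (0 : R).
    by apply: cvg_expr; rewrite ger0_norm ?invr_ge0// invf_lt1// ltr1n.
  by rewrite /= ger0_norm ?exprn_ge0 ?invr_ge0// => je; exists j.
exists (N j) => n jn; exact: le_trans (wu _ _ jn).2 je.
Unshelve. all: by end_near. Qed.

End riesz_fischer.

(** * Hilbert spaces of representatives *)

(** Vectors are representatives: the form may vanish on nonzero vectors, and two
    vectors at distance zero stand for the same element of the Hilbert space. *)
Record hilbert_form (R : realType) (V : lmodType R) := HilbertForm {
  ip :> V -> V -> R;
  ip_linearl : forall a u v x, ip (a *: u + v) x = a * ip u x + ip v x;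
  ipC : forall u v, ip u v = ip v u;
  ip_ge0 : forall u, 0 <= ip u u;
  ip_complete : forall z : nat -> V,
    (forall e, 0 < e -> exists N, forall m n, (N <= m)%N -> (N <= n)%N ->
       ip (z m - z n) (z m - z n) <= e) ->
    exists w, forall e, 0 < e ->
      exists N, forall n, (N <= n)%N -> ip (w - z n) (w - z n) <= e }.

Section hilbert_form_theory.
Context (R : realType) (V : lmodType R) (h : hilbert_form V).
Implicit Types u v w x : V.

Lemma ipZl a u x : h (a *: u) x = a * h u x.
Proof.
have h0 : h 0 x = 0.
  have := ip_linearl h 1 0 0 x; rewrite scale1r addr0 mul1r.
  by move=> /eqP; rewrite -subr_eq0 opprD addNKr oppr_eq0 => /eqP.
by have := ip_linearl h a u 0 x; rewrite addr0 h0 addr0.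
Qed.

Lemma ipDl u v x : h (u + v) x = h u x + h v x.
Proof. by have := ip_linearl h 1 u v x; rewrite scale1r mul1r. Qed.

Lemma ipNl u x : h (- u) x = - h u x.
Proof. by rewrite -scaleN1r ipZl mulN1r. Qed.

Lemma ipBl u v x : h (u - v) x = h u x - h v x.
Proof. by rewrite ipDl ipNl. Qed.

Lemma ip0l x : h 0 x = 0.
Proof. by rewrite -(scale0r 0) ipZl mul0r. Qed.

Lemma ipZr a u x : h x (a *: u) = a * h x u.
Proof. by rewrite ipC ipZl ipC. Qed.

Lemma ipDr u v x : h x (u + v) = h x u + h x v.
Proof. by rewrite ipC ipDl !(ipC h x). Qed.

Lemma ipNr u x : h x (- u) = - h x u.
Proof. by rewrite ipC ipNl ipC. Qed.

Lemma ip0r x : h x 0 = 0.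
Proof. by rewrite ipC ip0l. Qed.

Lemma ip_suml (I : Type) (s : seq I) (F : I -> V) x :
  h (\sum_(i <- s) F i) x = \sum_(i <- s) h (F i) x.
Proof.
elim: s => [|i s ih]; first by rewrite !big_nil ip0l.
by rewrite !big_cons ipDl ih.
Qed.

Definition ipE := (ipDl, ipDr, ipNl, ipNr, ipZl, ipZr, ip0l, ip0r).

(** Cauchy-Schwarz. Since the form is only semidefinite, the case [h v v = 0] also
    needs the sign of the quadratic polynomial [t |-> h (u + t v) (u + t v)]. *)
Lemma ip_sqr_le u v : (h u v) ^+ 2 <= h u u * h v v.
Proof.
have Q (t : R) : 0 <= h u u + 2 * t * h u v + t ^+ 2 * h v v.
  have := ip_ge0 h (u + t *: v); rewrite !ipE (ipC h v u).
  by congr (0 <= _); ring.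
have [vv|vv] := eqVneq (h v v) 0.
  rewrite vv mulr0; have [->|uv] := eqVneq (h u v) 0; first by rewrite expr0n.
  have := Q (- (h u u + 1) / (2 * h u v)).
  have -> : 2 * (- (h u u + 1) / (2 * h u v)) * h u v = - (h u u + 1).
    by field; rewrite uv.
  by rewrite vv mulr0; lra.
have vv0 : 0 < h v v by rewrite lt_neqAle eq_sym vv ip_ge0.
(* the minimum of the polynomial *)
have := Q (- h u v / h v v).
have -> : h u u + 2 * (- h u v / h v v) * h u v + (- h u v / h v v) ^+ 2 * h v v
    = (h u u * h v v - h u v ^+ 2) / h v v by field.
by rewrite pmulr_lge0 ?invr_gt0// subr_ge0.
Qed.

Definition nrm u : R := Num.sqrt (h u u).

Lemma nrm_ge0 u : 0 <= nrm u. Proof. exact: sqrtr_ge0. Qed.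

Lemma nrm_sqr u : nrm u ^+ 2 = h u u.
Proof. by rewrite sqr_sqrtr// ip_ge0. Qed.

Lemma ip_nrm_le u v : `|h u v| <= nrm u * nrm v.
Proof.
rewrite -ler_sqr ?nnegrE ?mulr_ge0 ?nrm_ge0//.
by rewrite real_normK ?num_real// exprMn !nrm_sqr ip_sqr_le.
Qed.

Lemma nrmD u v : nrm (u + v) <= nrm u + nrm v.
Proof.
rewrite -ler_sqr ?nnegrE ?addr_ge0 ?nrm_ge0// sqrrD !nrm_sqr !ipE (ipC h v u).
have := le_trans (ler_norm _) (ip_nrm_le u v); lra.
Qed.

Lemma nrmZ a u : nrm (a *: u) = `|a| * nrm u.
Proof.
by rewrite /nrm !ipE mulrA -expr2 sqrtrM ?sqr_ge0// sqrtr_sqr.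
Qed.

Lemma nrmN u : nrm (- u) = nrm u.
Proof. by rewrite -scaleN1r nrmZ normrN1 mul1r. Qed.

Lemma nrmBC u v : nrm (u - v) = nrm (v - u).
Proof. by rewrite -nrmN opprB. Qed.

Lemma nrm_tri u v w : nrm (u - w) <= nrm (u - v) + nrm (v - w).
Proof. by have := nrmD (u - v) (v - w); rewrite addrA subrK. Qed.

Definition null u := nrm u = 0.

Lemma null_ip u x : null u -> h u x = 0.
Proof.
move=> u0; apply/eqP; rewrite -normr_le0.
by apply: le_trans (ip_nrm_le _ _) _; rewrite u0 mul0r.
Qed.

Lemma nullP u : (forall x, h u x = 0) -> null u.
Proof. by move=> u0; rewrite /null /nrm u0 sqrtr0. Qed.

Lemma null_ipl u v x : null (u - v) -> h u x = h v x.
Proof. by move=> /null_ip-/(_ x); rewrite ipBl => /eqP; rewrite subr_eq0 => /eqP. Qed.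

Lemma null_nrm u v : null (u - v) -> nrm u = nrm v.
Proof.
by move=> uv; rewrite /nrm (null_ipl _ uv) ipC (null_ipl _ uv).
Qed.

Lemma nullC u v : null (u - v) -> null (v - u).
Proof. by rewrite /null nrmBC. Qed.

Lemma null0 : null 0.
Proof. by rewrite /null /nrm ip0l sqrtr0. Qed.

Lemma null_sqr u : h u u = 0 -> null u.
Proof. by move=> u0; rewrite /null /nrm u0 sqrtr0. Qed.

Definition tends (z_ : nat -> V) z := nrm (z - z_ n) @[n --> \oo] --> (0 : R).

Lemma tends_sqr z_ z :
  tends z_ z <-> h (z - z_ n) (z - z_ n) @[n --> \oo] --> (0 : R).
Proof.
split=> zz.
  under eq_cvg do rewrite -nrm_sqr expr2.
  by have := cvgM zz zz; rewrite mulr0; exact.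
rewrite /tends -(sqrtr0 R).
exact: (cvg_comp _ _ zz (@sqrt_continuous R 0)).
Qed.

Lemma tends_ip z_ z x : tends z_ z -> h (z_ n) x @[n --> \oo] --> h z x.
Proof.
move=> zz; apply/cvgrPdist_le => e e0.
have : nrm (z - z_ n) * nrm x @[n --> \oo] --> 0 * nrm x by apply: cvgM => //; exact: cvg_cst.
rewrite mul0r => /cvgr0Pnorm_le/(_ _ e0); apply: filterS => n.
rewrite -ipBl ger0_norm ?mulr_ge0 ?nrm_ge0//.
exact: le_trans (ip_nrm_le _ _).
Qed.

Lemma tends_nrm z_ z y : tends z_ z ->
  nrm (z_ n - y) @[n --> \oo] --> nrm (z - y).
Proof.
move=> zz; apply/cvgrPdist_le => e e0.
move/cvgr0Pnorm_le : zz => /(_ _ e0); apply: filterS => n.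
rewrite ger0_norm ?nrm_ge0//; apply: le_trans.
have := nrm_tri z (z_ n) y; have := nrm_tri (z_ n) z y.
by rewrite (nrmBC (z_ n) z) ler_norml; lra.
Qed.

Lemma tends_ip_sqr z_ z y : tends z_ z ->
  h (z_ n - y) (z_ n - y) @[n --> \oo] --> h (z - y) (z - y).
Proof.
move=> /tends_nrm-/(_ y) zz; under eq_cvg do rewrite -nrm_sqr expr2.
rewrite -nrm_sqr expr2; exact: (cvgM zz zz).
Qed.

Lemma tends_unique z_ z z' : tends z_ z -> tends z_ z' -> null (z - z').
Proof.
move=> zz /tends_sqr z'z; apply: null_sqr.
have := @tends_ip_sqr z_ z z' zz.
under eq_cvg do rewrite -nrm_sqr nrmBC nrm_sqr.
by move=> zz'; exact: (cvg_unique _ zz' z'z).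
Qed.

Lemma tends_linear z_ z y_ y a : tends z_ z -> tends y_ y ->
  tends (fun n => a *: z_ n + y_ n) (a *: z + y).
Proof.
move=> zz yy.
have lim0 : `|a| * nrm (z - z_ n) + nrm (y - y_ n) @[n --> \oo] --> (0 : R).
  rewrite -[0]addr0 -{1}(mulr0 `|a|); apply: cvgD => //.
  by apply: cvgM => //; exact: cvg_cst.
apply: (squeeze_cvgr _ (cvg_cst 0) lim0).
apply: nearW => n; rewrite nrm_ge0/= -nrmZ.
have -> : a *: z + y - (a *: z_ n + y_ n) = a *: (z - z_ n) + (y - y_ n).
  by rewrite scalerBr opprD addrACA.
exact: nrmD.
Qed.

End hilbert_form_theory.

(** * Step functions *)

Section step_functions.
Context d (T : measurableType d) (R : realType).
Implicit Types (l : seq (R * set T)) (x : T).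

Definition measurable_step l := forall p, p \in l -> measurable p.2.

Definition step_fun l x : R := \sum_(p <- l) p.1 * \1_(p.2) x.

Definition step_mul l l' :=
  [seq (p.1 * q.1, p.2 `&` q.2) | p <- l, q <- l'].

Definition step_sub l l' := l ++ [seq (- q.1, q.2) | q <- l'].

Lemma step_funM l l' x :
  step_fun (step_mul l l') x = step_fun l x * step_fun l' x.
Proof.
rewrite /step_fun big_allpairs_dep mulr_suml; apply: eq_bigr => p _.
rewrite mulr_sumr; apply: eq_bigr => q _ /=.
by rewrite indicI /=; ring.
Qed.

Lemma step_funB l l' x :
  step_fun (step_sub l l') x = step_fun l x - step_fun l' x.
Proof.
rewrite /step_fun big_cat big_map -sumrN; congr (_ + _).
by apply: eq_bigr => q _ /=; rewrite mulNr.
Qed.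

Lemma step_fun1 a A x : step_fun [:: (a, A)] x = a * \1_A x.
Proof. by rewrite /step_fun big_seq1. Qed.

Lemma measurable_step0 : measurable_step [::].
Proof. by []. Qed.

Lemma measurable_step1 a A : measurable A -> measurable_step [:: (a, A)].
Proof. by move=> mA p; rewrite inE => /eqP->. Qed.

Lemma measurable_step_mul l l' : measurable_step l -> measurable_step l' ->
  measurable_step (step_mul l l').
Proof.
move=> ml ml' _ /allpairsP[[p q] /= [pl ql' ->]] /=.
by apply: measurableI; [exact: ml|exact: ml'].
Qed.

Lemma measurable_step_sub l l' : measurable_step l -> measurable_step l' ->
  measurable_step (step_sub l l').
Proof.
move=> ml ml' p; rewrite mem_cat => /orP[/ml//|/mapP[q /ml' mq ->//]].
Qed.

Lemma step_fun_measurable l : measurable_step l ->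
  measurable_fun setT (step_fun l).
Proof.
elim: l => [|p l ih] ml.
  rewrite (_ : step_fun _ = cst 0); first exact: measurable_cst.
  by apply/funext => x; rewrite /step_fun big_nil.
rewrite (_ : step_fun _ = fun x => p.1 * \1_(p.2) x + step_fun l x).
  apply: measurable_funD; last first.
    by apply: ih => q ql; apply: ml; rewrite inE ql orbT.
  apply: measurable_funM; first exact: measurable_cst.
  by apply: measurable_indic; apply: ml; rewrite inE eqxx.
by apply/funext => x; rewrite /step_fun big_cons.
Qed.

Lemma step_fun_bounded l : exists2 C, 0 <= C & forall x, `|step_fun l x| <= C.
Proof.
exists (\sum_(p <- l) `|p.1|); first by apply: sumr_ge0.
move=> x; apply: le_trans (ler_norm_sum _ _ _) _; apply: ler_sum => p _.
by rewrite normrM ler_piMr// indicE; case: (_ \in _); rewrite /= ?normr1 ?normr0.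
Qed.

Import HBNNSimple HBSimple.

Lemma nnsfun_step (g : {nnsfun T >-> R}) :
  exists2 l, measurable_step l & step_fun l =1 g.
Proof.
exists [seq (y, g @^-1` [set y]) | y <- finmap.enum_fset (fset_set (range g))].
  by move=> _ /mapP[y _ ->] /=; exact: measurable_funPTI.
move=> x; rewrite /step_fun big_map fimfunE fsbig_finite//.
Qed.

(** The positive and negative parts are approximated from below. At each point
    one of them vanishes, so that the difference stays below [phi] in absolute
    value. *)
Lemma step_approximation (phi : T -> R) : measurable_fun setT phi ->
  exists l : nat -> seq (R * set T), [/\ forall n, measurable_step (l n),
    forall n x, `|step_fun (l n) x| <= `|phi x| &
    forall x, step_fun (l n) x @[n --> \oo] --> phi x].
Proof.
move=> mphi.
have approx (f : T -> R) : measurable_fun setT f -> (forall x, 0 <= f x) ->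
    exists l : nat -> seq (R * set T), [/\ forall n, measurable_step (l n),
      forall n x, 0 <= step_fun (l n) x <= f x &
      forall x, step_fun (l n) x @[n --> \oo] --> f x].
  move=> mf f0; have mf' : measurable_fun setT (EFin \o f).
    exact/measurable_EFinP.
  have f0' x : [set: T] x -> (0 <= (EFin \o f) x)%E by rewrite /= lee_fin.
  pose g := nnsfun_approx measurableT mf'.
  have /choice[l gl] n : exists l, measurable_step l /\ step_fun l =1 g n.
    by have [l ? ?] := nnsfun_step (g n); exists l.
  exists l; split=> [n|n x|x].
  - by have [] := gl n.
  - have [_ ->] := gl n; rewrite fun_ge0/= -lee_fin /g nnsfun_approxE.
    exact: le_approx.
  - under eq_cvg => n do rewrite (proj2 (gl n) x).
    have /fine_cvgP[_] := @cvg_nnsfun_approx _ _ _ _ measurableT _ mf' f0' x I.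
    exact.
have [lp [mlp lpb lpc]] := approx _ (measurable_funrpos mphi) (funrpos_ge0 phi).
have [ln [mln lnb lnc]] := approx _ (measurable_funrneg mphi) (funrneg_ge0 phi).
exists (fun n => step_sub (lp n) (ln n)); split=> [n|n x|x].
- exact: measurable_step_sub.
- rewrite step_funB.
  have /andP[] := lpb n x; have /andP[] := lnb n x; rewrite /funrpos /funrneg /=.
  have [p0|p0] := leP 0 (phi x).
    rewrite (max_idPr _) ?oppr_le0// => ? ? ? ?.
    by rewrite (ger0_norm p0) ler_norml; lra.
  have p0' : 0 <= - phi x by rewrite oppr_ge0 ltW.
  rewrite (max_idPl p0') => ? ? ? ?.
  by rewrite (ltr0_norm p0) ler_norml; lra.
- under eq_cvg do rewrite step_funB.
  have -> : phi x = phi^\+ x - phi^\- x by rewrite -{1}(funrposBneg phi).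
  exact: cvgB.
Qed.

End step_functions.

(** * Functions of a self-adjoint operator *)

(** A projection-valued measure, its identities being tested against vectors
    because the projections act on representatives. *)
Record spectral_family d (T : measurableType d) (R : realType)
    (V : lmodType R) (h : hilbert_form V) := SpectralFamily {
  sproj : set T -> V -> V;
  smeas : V -> {measure set T -> \bar R};
  proj_linear : forall A a u v x, measurable A ->
    h (sproj A (a *: u + v)) x = a * h (sproj A u) x + h (sproj A v) x;
  proj_sym : forall A u v, measurable A -> h (sproj A u) v = h u (sproj A v);
  projT : forall u x, h (sproj setT u) x = h u x;
  projI : forall A B u x, measurable A -> measurable B ->
    h (sproj (A `&` B) u) x = h (sproj A (sproj B u)) x;
  smeasE : forall u A, measurable A -> smeas u A = (h (sproj A u) u)%:E }.

Section spectral_calculus.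
Context d (T : measurableType d) (R : realType) (V : lmodType R).
Context (h : hilbert_form V) (S : spectral_family T h).
Local Notation m := (smeas S).
Implicit Types (l : seq (R * set T)) (phi psi : T -> R) (u v w : V).

Lemma smeas_setT u : m u setT = (h u u)%:E.
Proof. by rewrite smeasE// projT. Qed.

Lemma bounded_Lfun2 phi C u : measurable_fun setT phi ->
  (forall x, `|phi x| <= C) -> phi \in Lfun (m u) 2%:E.
Proof.
move=> mphi phiC; apply: (@Lfun2_le _ _ _ _ _ (cst C)) => //.
  apply: Lfun2P => //.
  rewrite (integral_cst (m u) measurableT (C ^+ 2)%:E) smeas_setT.
  by rewrite -EFinM ltry.
by move=> x; apply: le_trans (phiC x) _; exact: ler_norm.
Qed.

Lemma Lfun2_cst C u : cst C \in Lfun (m u) 2%:E.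
Proof. by apply: (@bounded_Lfun2 _ `|C|). Qed.

Lemma Lfun2_integrable phi u : phi \in Lfun (m u) 2%:E ->
  (m u).-integrable setT (EFin \o phi).
Proof.
move=> phi2; have := Lfun2_mul phi2 (Lfun2_cst 1 u).
by apply: eq_integrable => // x _; rewrite /= mulr1.
Qed.

Lemma step_Lfun2 l u : measurable_step l -> step_fun l \in Lfun (m u) 2%:E.
Proof.
move=> ml; have [C _ lC] := step_fun_bounded l.
by apply: bounded_Lfun2 lC; exact: step_fun_measurable.
Qed.

Lemma Rintegral_indic_smeas A u : measurable A ->
  \int[m u]_x \1_A x = h (sproj S A u) u.
Proof.
by move=> mA; rewrite /Rintegral integral_indic// setIT smeasE.
Qed.

Definition step_op l u : V := \sum_(p <- l) p.1 *: sproj S p.2 u.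

Lemma ip_step_op l u x :
  h (step_op l u) x = \sum_(p <- l) p.1 * h (sproj S p.2 u) x.
Proof. by rewrite ip_suml; apply: eq_bigr => p _; rewrite ipZl. Qed.

Lemma step_op_linear l a u v x : measurable_step l ->
  h (step_op l (a *: u + v)) x = a * h (step_op l u) x + h (step_op l v) x.
Proof.
move=> ml; rewrite !ip_step_op mulr_sumr -big_split /=.
apply: eq_big_seq => p pl; rewrite proj_linear; last exact: ml.
by ring.
Qed.

Lemma step_op_sym l u v : measurable_step l ->
  h (step_op l u) v = h u (step_op l v).
Proof.
move=> ml; rewrite ip_step_op ipC ip_step_op.
apply: eq_big_seq => p pl; rewrite proj_sym; last exact: ml.
by rewrite ipC.
Qed.

Lemma step_op_sub l l' u :
  step_op (step_sub l l') u = step_op l u - step_op l' u.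
Proof.
rewrite /step_op big_cat big_map -sumrN; congr (_ + _).
by apply: eq_bigr => q _; rewrite scaleNr.
Qed.

Lemma step_op_mul l l' u x : measurable_step l -> measurable_step l' ->
  h (step_op (step_mul l l') u) x = h (step_op l (step_op l' u)) x.
Proof.
move=> ml ml'; rewrite (step_op_sym _ _ ml) !ip_step_op big_allpairs_dep /=.
under [RHS]eq_bigr do rewrite ipC ip_step_op mulr_sumr.
rewrite [RHS]exchange_big /=.
apply: eq_big_seq => p pl; apply: eq_big_seq => q ql'.
have mp := ml p pl; have mq := ml' q ql'.
rewrite projI// (proj_sym S (sproj S q.2 u) x mp) (ipC h (sproj S p.2 x)).
by ring.
Qed.

Lemma Rintegral_step l u : measurable_step l ->
  \int[m u]_x step_fun l x = h (step_op l u) u.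
Proof.
elim: l => [_|p l ih ml].
  rewrite /step_op big_nil ip0l; under eq_Rintegral do rewrite /step_fun big_nil.
  by rewrite Rintegral_cst// mul0r.
have mp : measurable p.2 by apply: ml; rewrite inE eqxx.
have ml' : measurable_step l by move=> q ql; apply: ml; rewrite inE ql orbT.
rewrite /step_op big_cons ipDl ipZl -[X in _ + h X _]/(step_op l u) -ih//.
rewrite -Rintegral_indic_smeas// -RintegralZl//; last first.
  apply: Lfun2_integrable; apply: (@bounded_Lfun2 _ 1) => //.
  by move=> x; rewrite indicE; case: (_ \in _); rewrite /= ?normr1 ?normr0.
rewrite -RintegralD//.
- by apply: eq_Rintegral => x _; rewrite /step_fun big_cons.
- apply: Lfun2_integrable; have := step_Lfun2 u (@measurable_step1 _ _ _ p.1 _ mp).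
  by rewrite (_ : step_fun _ = fun x => p.1 * \1_(p.2) x)//; apply/funext => x;
    rewrite step_fun1.
- by apply: Lfun2_integrable; exact: step_Lfun2.
Qed.

(** Projections multiply like indicator functions, so that
    [(s(L) u, s(L) u) = (s^2(L) u, u)]. *)
Lemma step_op_sqr l u : measurable_step l ->
  h (step_op l u) (step_op l u) = \int[m u]_x (step_fun l x) ^+ 2.
Proof.
move=> ml; rewrite -step_op_sym// -step_op_mul// -Rintegral_step//.
  by apply: eq_Rintegral => x _; rewrite step_funM.
exact: measurable_step_mul.
Qed.

Lemma step_op_dist l l' u : measurable_step l -> measurable_step l' ->
  h (step_op l u - step_op l' u) (step_op l u - step_op l' u) =
  \int[m u]_x (step_fun l x - step_fun l' x) ^+ 2.
Proof.
move=> ml ml'; rewrite -step_op_sub step_op_sqr.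
  by apply: eq_Rintegral => x _; rewrite step_funB.
exact: measurable_step_sub.
Qed.

Lemma step_op_bounded l : measurable_step l ->
  exists2 C, 0 <= C & forall u, nrm h (step_op l u) <= C * nrm h u.
Proof.
move=> ml; have [C C0 lC] := step_fun_bounded l; exists C => // u.
rewrite -ler_sqr ?nnegrE ?mulr_ge0 ?nrm_ge0// nrm_sqr step_op_sqr//.
rewrite exprMn nrm_sqr.
apply: (@le_trans _ _ (\int[m u]_x (cst (C ^+ 2) x))).
  apply: le_Rintegral => //.
  - exact: (Lfun2_integrable_sqr (step_Lfun2 u ml)).
  - exact: (Lfun2_integrable (Lfun2_cst _ u)).
  - by move=> x _; rewrite -(real_normK (num_real (step_fun l x))) lerXn2r ?nnegrE.
by rewrite Rintegral_cst// smeas_setT.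
Qed.

Lemma tends_step_op l z_ z : measurable_step l -> tends h z_ z ->
  tends h (fun n => step_op l (z_ n)) (step_op l z).
Proof.
move=> ml zz; have [C C0 hC] := step_op_bounded ml.
have lim0 : C * nrm h (z - z_ n) @[n --> \oo] --> (0 : R).
  by rewrite -(mulr0 C); apply: cvgM => //; exact: cvg_cst.
apply: (squeeze_cvgr _ (cvg_cst 0) lim0).
apply: nearW => n; rewrite nrm_ge0/=.
rewrite (@null_nrm _ _ _ _ (step_op l (z - z_ n))) ?hC//.
apply: nullP => x; rewrite !ipBl addrC (addrC z) -scaleN1r step_op_linear//.
by ring.
Qed.

(** [w] is [phi(L) u]. The map sending a step function [s] to [s(L) u] is an
    isometry from L2(m_u), and [w] is the image of [phi] under its extension;
    prescribing the distances of [w] to the values of step functions fixes it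
    without choosing a sequence. *)
Definition calc phi u w :=
  phi \in Lfun (m u) 2%:E /\
  forall l, measurable_step l ->
    h (w - step_op l u) (w - step_op l u) =
    \int[m u]_x (phi x - step_fun l x) ^+ 2.

Lemma calc_tends phi u w (l_ : nat -> seq (R * set T)) : calc phi u w ->
  (forall n, measurable_step (l_ n)) ->
  (forall n x, `|step_fun (l_ n) x| <= `|phi x|) ->
  (forall x, step_fun (l_ n) x @[n --> \oo] --> phi x) ->
  tends h (fun n => step_op (l_ n) u) w.
Proof.
move=> [phi2 cphi] ml l_le l_phi; apply/tends_sqr.
under eq_cvg do rewrite cphi//.
have := Lfun2_dominated_dist (fun n => step_fun_measurable (ml n)) l_le l_phi
  phi2 phi2.
rewrite [X in _ --> X](_ : _ = 0).
  apply: cvg_trans; apply: near_eq_cvg; apply: nearW => n.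
  by apply: eq_Rintegral => x _; rewrite -sqrrN opprB.
by under eq_Rintegral do rewrite subrr expr0n; rewrite Rintegral_cst// mul0r.
Qed.

(** Dominated approximations of [phi] are Cauchy in L2(m_u), hence so are their
    values at [u]. *)
Lemma calc_exists phi u : phi \in Lfun (m u) 2%:E -> exists w, calc phi u w.
Proof.
move=> phi2; have mphi := Lfun2_measurable phi2.
have [l [ml l_le l_phi]] := step_approximation mphi.
have d0 := Lfun2_dominated_dist (fun n => step_fun_measurable (ml n)) l_le l_phi
  phi2 phi2.
have {}d0 : \int[m u]_x (step_fun (l n) x - phi x) ^+ 2 @[n --> \oo] --> (0 : R).
  move: d0; rewrite [X in _ --> X -> _](_ : _ = 0)//.
  by under eq_Rintegral do rewrite subrr expr0n; rewrite Rintegral_cst// mul0r.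
have [|w hw] := @ip_complete _ _ h (fun n => step_op (l n) u).
  move=> e e0; have e4 : 0 < e / 4 by rewrite divr_gt0.
  move/cvgr0Pnorm_le : d0 => /(_ _ e4)[N _ HN]; exists N => i j Ni Nj.
  rewrite step_op_dist//.
  have li k : (fun x => step_fun (l k) x - phi x) \in Lfun (m u) 2%:E.
    by apply: Lfun2B => //; exact: step_Lfun2.
  have bnd k : (N <= k)%N -> \int[m u]_x (step_fun (l k) x - phi x) ^+ 2 <= e / 4.
    by move=> Nk; apply: le_trans (ler_norm _) _; exact: HN.
  have := Rintegral_sqrB_le (li i) (li j).
  rewrite [X in X <= _](_ : _ =
    \int[m u]_x (step_fun (l i) x - step_fun (l j) x) ^+ 2); last first.
    by apply: eq_Rintegral => x _; congr (_ ^+ 2); ring.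
  have := bnd _ Ni; have := bnd _ Nj; lra.
exists w; split=> // l' ml'.
have tw : tends h (fun n => step_op (l n) u) w.
  apply/tends_sqr/cvgrPdist_le => e e0; have [N HN] := hw _ e0.
  exists N => // n /HN hn; rewrite sub0r normrN ger0_norm//; exact: ip_ge0.
have := @tends_ip_sqr _ _ _ _ _ (step_op l' u) tw.
under eq_cvg do rewrite step_op_dist//.
move=> tl; apply: (cvg_unique _ tl) => //.
apply: (Lfun2_dominated_dist (fun n => step_fun_measurable (ml n))) => //.
exact: step_Lfun2.
Qed.

End spectral_calculus.

Section spectral_calculus_theory.
Context d (T : measurableType d) (R : realType) (V : lmodType R).
Context (h : hilbert_form V) (S : spectral_family T h).
Local Notation m := (smeas S).
Implicit Types (l : seq (R * set T)) (phi psi : T -> R) (u v w : V).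

Lemma calc_step l u : measurable_step l -> calc S (step_fun l) u (step_op S l u).
Proof.
by move=> ml; split=> [|l' ml']; [exact: step_Lfun2|exact: step_op_dist].
Qed.

Lemma calc_unique phi u w w' : calc S phi u w -> calc S phi u w' ->
  null h (w - w').
Proof.
move=> cw cw'; have mphi := Lfun2_measurable cw.1.
have [l [ml l_le l_phi]] := step_approximation mphi.
exact: tends_unique (calc_tends cw ml l_le l_phi) (calc_tends cw' ml l_le l_phi).
Qed.

Lemma calc_null phi u w w' : calc S phi u w -> null h (w - w') ->
  calc S phi u w'.
Proof.
move=> [phi2 cw] ww'; split=> // l ml; rewrite -cw// -!nrm_sqr.
congr (_ ^+ 2); apply: null_nrm.
by rewrite opprB addrA subrK; exact: nullC.
Qed.

Lemma calc_sqr phi u w : calc S phi u w -> h w w = \int[m u]_x (phi x) ^+ 2.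
Proof.
move=> [_ /(_ [::])]; rewrite /step_op big_nil subr0 => -> //.
by apply: eq_Rintegral => x _; rewrite /step_fun big_nil subr0.
Qed.

(** The isometry, polarized *)
Lemma calc_ip_step phi u w l : calc S phi u w -> measurable_step l ->
  h w (step_op S l u) = \int[m u]_x (phi x * step_fun l x).
Proof.
move=> cw ml; have [phi2 /(_ _ ml)] := cw.
rewrite !ipE (calc_sqr cw) step_op_sqr// (ipC h (step_op S l u)).
have s2 := step_Lfun2 S u ml.
have i1 := Lfun2_integrable_sqr phi2; have i2 := Lfun2_integrable_sqr s2.
have i3 := Lfun2_mul phi2 s2.
have -> : \int[m u]_x (phi x - step_fun l x) ^+ 2 =
    \int[m u]_x (phi x ^+ 2) - \int[m u]_x (phi x * step_fun l x)
    + (\int[m u]_x (step_fun l x ^+ 2) - \int[m u]_x (phi x * step_fun l x)).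
  rewrite -!RintegralB// -RintegralD//.
  - by apply: eq_Rintegral => x _; ring.
  - have := integrableB measurableT i1 i3.
    by apply: eq_integrable => // x _; rewrite /= EFinB.
  - have := integrableB measurableT i2 i3.
    by apply: eq_integrable => // x _; rewrite /= EFinB.
lra.
Qed.

Lemma calc_ip_self phi u w : calc S phi u w -> h w u = \int[m u]_x phi x.
Proof.
move=> cw; have := calc_ip_step cw (@measurable_step1 _ _ _ 1 _ measurableT).
rewrite /step_op big_seq1 scale1r ipC projT ipC => ->.
by apply: eq_Rintegral => x _; rewrite step_fun1 indicE in_setT !mulr1.
Qed.

Lemma calc_ae phi psi u w : calc S phi u w -> measurable_fun setT psi ->
  {ae m u, forall x, phi x = psi x} -> calc S psi u w.
Proof.
move=> [phi2 cw] mpsi pp; have mphi := Lfun2_measurable phi2; split.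
  apply: Lfun2P => //; have := Lfun2_sqr_lty phi2.
  rewrite (@ae_eq_integral _ _ _ _ _ (EFin \o (fun x => (psi x) ^+ 2)))//.
  - by apply/measurable_EFinP; exact: measurable_funX.
  - by apply/measurable_EFinP; exact: measurable_funX.
  - by apply: filterS pp => x /= -> _.
move=> l ml; rewrite cw//; apply: ae_eq_Rintegral.
- apply: measurable_funX; apply: measurable_funB => //.
  exact: step_fun_measurable.
- apply: measurable_funX; apply: measurable_funB => //.
  exact: step_fun_measurable.
- by apply: filterS pp => x /= ->.
Qed.

(** A membership test which avoids comparing the measures of different vectors:
    by [step_op_sqr] the integrals are squared norms of values of bounded
    operators. *)
Lemma calc_dom phi u C : measurable_fun setT phi ->
  (forall l, measurable_step l -> (forall x, `|step_fun l x| <= `|phi x|) ->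
     \int[m u]_x (step_fun l x) ^+ 2 <= C) ->
  phi \in Lfun (m u) 2%:E.
Proof.
move=> mphi lC; have [l [ml l_le l_phi]] := step_approximation mphi.
have l2 n : step_fun (l n) \in Lfun (m u) 2%:E by exact: step_Lfun2.
have bnd : \forall n \near \oo, \int[m u]_x (step_fun (l n) x) ^+ 2 <= C.
  by apply: nearW => n; exact: lC.
exact: (Lfun2_cvg_bound l2 l_phi bnd).1.
Qed.

Lemma null_step_op l u v : measurable_step l -> null h (u - v) ->
  null h (step_op S l u - step_op S l v).
Proof.
move=> ml uv; apply: nullP => x.
by rewrite ipBl !step_op_sym// (null_ipl _ uv) subrr.
Qed.

Lemma Lfun2_smeas_le phi l u : phi \in Lfun (m u) 2%:E -> measurable_step l ->
  (forall x, `|step_fun l x| <= `|phi x|) ->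
  h (step_op S l u) (step_op S l u) <= \int[m u]_x (phi x) ^+ 2.
Proof.
move=> phi2 ml l_le; rewrite step_op_sqr//; apply: le_Rintegral => //.
- exact: (Lfun2_integrable_sqr (step_Lfun2 S u ml)).
- exact: (Lfun2_integrable_sqr phi2).
- move=> x _; rewrite -(real_normK (num_real (step_fun l x))).
  by rewrite -(real_normK (num_real (phi x))) lerXn2r ?nnegrE.
Qed.

Lemma calc_dom_linear phi a u v : phi \in Lfun (m u) 2%:E ->
  phi \in Lfun (m v) 2%:E -> phi \in Lfun (m (a *: u + v)) 2%:E.
Proof.
move=> u2 v2; have mphi := Lfun2_measurable u2.
pose C := 2 * (a ^+ 2 * \int[m u]_x (phi x) ^+ 2) +
          2 * \int[m v]_x (phi x) ^+ 2.
apply: (@calc_dom _ _ C) => // l ml l_le.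
rewrite -step_op_sqr// -nrm_sqr.
rewrite (@null_nrm _ _ _ _ (a *: step_op S l u + step_op S l v)); last first.
  by apply: nullP => x; rewrite ipBl step_op_linear// !ipE subrr.
rewrite nrm_sqr; have := ip_ge0 h (a *: step_op S l u - step_op S l v).
have := ler_wpM2l (sqr_ge0 a) (Lfun2_smeas_le u2 ml l_le).
have := Lfun2_smeas_le v2 ml l_le.
rewrite /C !ipE (ipC h (step_op S l v)); lra.
Qed.

Lemma calc_linear phi a u v w y : calc S phi u w -> calc S phi v y ->
  calc S phi (a *: u + v) (a *: w + y).
Proof.
move=> cw cy; have mphi := Lfun2_measurable cw.1.
have [z cz] := calc_exists (calc_dom_linear a cw.1 cy.1).
apply: (calc_null cz).
have [l [ml l_le l_phi]] := step_approximation mphi.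
have tz := calc_tends cz ml l_le l_phi.
have tl := tends_linear a (calc_tends cw ml l_le l_phi)
                        (calc_tends cy ml l_le l_phi).
apply: (tends_unique (z_ := fun n => a *: step_op S (l n) u + step_op S (l n) v)) tl.
move: tz; apply: cvg_trans; apply: near_eq_cvg; apply: nearW => n /=.
apply: null_nrm; apply: nullP => x.
by rewrite !ipE step_op_linear//; ring.
Qed.

(** The isometry commutes with affine changes of [phi], as [a + b s] is a step
    function when [s] is one. *)
Lemma calc_compl phi c u w : c != 0 -> calc S phi u w ->
  calc S (fun x => (1 - phi x) / c) u (c^-1 *: (u - w)).
Proof.
move=> c0 [phi2 cw]; split.
  have := Lfun2Z c^-1 (Lfun2B (Lfun2_cst S 1 u) phi2).
  by rewrite (_ : (fun x => _) = (fun x => (1 - phi x) / c))//;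
    apply/funext => x; rewrite mulrC.
move=> l ml.
pose l' := step_sub [:: (1, setT)] (step_mul [:: (c, setT)] l).
have ml1 := @measurable_step1 _ _ _ (1 : R) (setT : set T) measurableT.
have mlc := @measurable_step1 _ _ _ c (setT : set T) measurableT.
have ml' : measurable_step l'.
  by apply: measurable_step_sub => //; exact: measurable_step_mul.
have e x : step_fun l' x = 1 - c * step_fun l x.
  by rewrite step_funB step_funM !step_fun1 indicE in_setT !mulr1.
have E : null h (w - step_op S l' u + c *: (c^-1 *: (u - w) - step_op S l u)).
  apply: nullP => x; rewrite step_op_sub ipDl !ipBl ipZl ipBl ipZl ipBl.
  rewrite step_op_mul// {1 2}/step_op !big_seq1 scale1r ipZl !projT.
  by rewrite /=; field.
have -> : h (c^-1 *: (u - w) - step_op S l u) (c^-1 *: (u - w) - step_op S l u)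
    = (c ^+ 2)^-1 * h (w - step_op S l' u) (w - step_op S l' u).
  move: E; set p := w - _; set q := _ - step_op S l u => E.
  have /null_nrm pq : null h (p - (- (c *: q))) by rewrite opprK.
  rewrite -(nrm_sqr h p) pq nrmN nrmZ exprMn real_normK ?num_real// nrm_sqr.
  by field.
rewrite cw// -RintegralZl//.
  by apply: eq_Rintegral => x _; rewrite e; field.
by apply: Lfun2_integrable_sqr; apply: Lfun2B => //; exact: step_Lfun2.
Qed.

(** Step functions of the operator are bounded, so that [l(L) w] is the limit of
    [(l l_n)(L) u] for step functions [l_n] tending to [phi]. *)
Lemma step_op_calc_dist phi psi u w y l : calc S phi u w -> calc S psi u y ->
  measurable_step l ->
  h (step_op S l w - y) (step_op S l w - y) =
  \int[m u]_x (step_fun l x * phi x - psi x) ^+ 2.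
Proof.
move=> cw cy ml; have mphi := Lfun2_measurable cw.1.
have [l_ [ml_ l_le l_phi]] := step_approximation mphi.
have := @tends_ip_sqr _ _ _ _ _ y (tends_step_op S ml (calc_tends cw ml_ l_le l_phi)).
have mll n := measurable_step_mul ml (ml_ n).
have e n : h (step_op S l (step_op S (l_ n) u) - y)
             (step_op S l (step_op S (l_ n) u) - y) =
           \int[m u]_x (step_fun (step_mul l (l_ n)) x - psi x) ^+ 2.
  have -> : \int[m u]_x (step_fun (step_mul l (l_ n)) x - psi x) ^+ 2 =
            \int[m u]_x (psi x - step_fun (step_mul l (l_ n)) x) ^+ 2.
    by apply: eq_Rintegral => x _; rewrite -sqrrN opprB.
  rewrite -cy.2// -!nrm_sqr [in RHS]nrmBC; congr (_ ^+ 2).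
  by apply: null_nrm; apply: nullP => x; rewrite !ipBl step_op_mul//; ring.
under eq_cvg do rewrite e.
move=> lim1; apply: (cvg_unique _ lim1) => //.
have lphi2 : (fun x => step_fun l x * phi x) \in Lfun (m u) 2%:E.
  have [C C0 lC] := step_fun_bounded l.
  apply: (Lfun2_le _ (Lfun2Z C cw.1)).
    by apply: measurable_funM => //; exact: step_fun_measurable.
  by move=> x; rewrite !normrM (ger0_norm C0) ler_wpM2r.
apply: Lfun2_dominated_dist => //.
- by move=> n; exact: step_fun_measurable.
- by move=> n x; rewrite step_funM !normrM ler_wpM2l.
- move=> x; under eq_cvg do rewrite step_funM.
  by apply: cvgM => //; exact: cvg_cst.
- exact: cy.1.
Qed.

(** Composition. For step functions [l] tending to [psi], the vectors [l(L) w] tend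
    to [psi(L) w] and, by [step_op_calc_dist], also to [y]. *)
Lemma calc_comp phi psi u w y : calc S phi u w -> measurable_fun setT psi ->
  calc S (fun x => psi x * phi x) u y -> calc S psi w y.
Proof.
move=> cw mpsi cy.
have w2 : psi \in Lfun (m w) 2%:E.
  apply: (@calc_dom _ _ (\int[m u]_x (psi x * phi x) ^+ 2)) => // l ml l_le.
  have c0 := calc_step u (@measurable_step0 _ T R).
  have := step_op_calc_dist cw c0 ml.
  rewrite {2 4}/step_op big_nil subr0 step_op_sqr// => ->.
  have cl := cy.1.
  have l2 : (fun x => step_fun l x * phi x) \in Lfun (m u) 2%:E.
    apply: (Lfun2_le _ cl) => [|x]; last by rewrite !normrM ler_wpM2r.
    apply: measurable_funM; first exact: step_fun_measurable.
    exact: Lfun2_measurable cw.1.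
  apply: le_Rintegral => //.
  - have := Lfun2_integrable_sqr l2; apply: eq_integrable => // x _ /=.
    by rewrite /step_fun big_nil subr0.
  - exact: Lfun2_integrable_sqr cl.
  - move=> x _; rewrite [step_fun [::] x]big_nil subr0.
    rewrite -(real_normK (num_real (step_fun l x * phi x))).
    rewrite -(real_normK (num_real (psi x * phi x))) lerXn2r ?nnegrE//.
    by rewrite !normrM ler_wpM2r.
have [z cz] := calc_exists w2; apply: (calc_null cz).
have [l [ml l_le l_psi]] := step_approximation mpsi.
apply: (tends_unique (calc_tends cz ml l_le l_psi)).
apply/tends_sqr.
under eq_cvg do rewrite -nrm_sqr nrmBC nrm_sqr (step_op_calc_dist cw cy (ml _)).
have e0 : \int[m u]_x (psi x * phi x - psi x * phi x) ^+ 2 = 0.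
  by under eq_Rintegral do rewrite subrr expr0n; rewrite Rintegral_cst// mul0r.
suff : \int[m u]_x (step_fun (l n) x * phi x - psi x * phi x) ^+ 2 @[n --> \oo]
    --> \int[m u]_x (psi x * phi x - psi x * phi x) ^+ 2 by rewrite e0.
apply: Lfun2_dominated_dist; [| | |exact: cy.1|exact: cy.1].
- move=> n; apply: measurable_funM; first exact: step_fun_measurable.
  exact: Lfun2_measurable cw.1.
- by move=> n x; rewrite !normrM ler_wpM2r.
- by move=> x; apply: cvgM => //; exact: cvg_cst.
Qed.

Lemma calc_proj A u : measurable A -> calc S \1_A u (sproj S A u).
Proof.
move=> mA; have := calc_step u (@measurable_step1 _ _ _ 1 _ mA).
rewrite /step_op big_seq1 scale1r.
by rewrite (_ : step_fun _ = \1_A)//; apply/funext => x; rewrite step_fun1 mul1r.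
Qed.

Lemma Rintegral_smeas_cvg phi u (l_ : nat -> seq (R * set T)) :
  phi \in Lfun (m u) 2%:E -> (forall n, measurable_step (l_ n)) ->
  (forall n x, `|step_fun (l_ n) x| <= `|phi x|) ->
  (forall x, step_fun (l_ n) x @[n --> \oo] --> phi x) ->
  h (step_op S (l_ n) u) u @[n --> \oo] --> \int[m u]_x phi x.
Proof.
move=> phi2 ml l_le l_phi.
under eq_cvg do rewrite -Rintegral_step//.
apply: (Rintegral_dominated_cvg (g := fun x => `|phi x|)) => //.
- by move=> n; exact: step_fun_measurable.
- by have /integrable_abse := Lfun2_integrable phi2.
Qed.

(** The matrix element [(phi(L) u, v)], recovered from the measures [m_x] *)
Definition polar phi u v : R :=
  (\int[m (u + v)]_x phi x - \int[m (u - v)]_x phi x) / 4.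

Lemma calc_polar phi u v w : calc S phi u w -> phi \in Lfun (m v) 2%:E ->
  h w v = polar phi u v.
Proof.
move=> cw v2; have mphi := Lfun2_measurable v2.
have [l [ml l_le l_phi]] := step_approximation mphi.
have uv2 : phi \in Lfun (m (u + v)) 2%:E.
  by rewrite -(scale1r u); apply: calc_dom_linear => //; exact: cw.1.
have uNv2 : phi \in Lfun (m (u - v)) 2%:E.
  by rewrite addrC -scaleN1r; apply: calc_dom_linear => //; exact: cw.1.
have lim1 := Rintegral_smeas_cvg uv2 ml l_le l_phi.
have lim2 := Rintegral_smeas_cvg uNv2 ml l_le l_phi.
have lim3 := @tends_ip _ _ _ _ _ v (calc_tends cw ml l_le l_phi).
apply: (cvg_unique _ lim3) => //.
have lim4 : (h (step_op S (l n) (u + v)) (u + v) -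
    h (step_op S (l n) (u - v)) (u - v)) / 4 @[n --> \oo] --> polar phi u v.
  by apply: cvgM; [exact: cvgB|exact: cvg_cst].
move: lim4; apply: cvg_trans; apply: near_eq_cvg; apply: nearW => n /=.
rewrite -[X in h (step_op S _ (X + v))]scale1r.
rewrite [X in h (step_op S _ X) (u - v)]addrC -scaleN1r !step_op_linear// !ipE.
have -> : h (step_op S (l n) v) u = h (step_op S (l n) u) v.
  by rewrite step_op_sym// ipC.
by field.
Qed.

(** The vectors [E(|phi| <= n) w] lie in the domain of [phi(L)] and tend to [w]. *)
Lemma calc_dom_dense phi w : measurable_fun setT phi ->
  (forall v, phi \in Lfun (m v) 2%:E -> h w v = 0) -> null h w.
Proof.
move=> mphi w0.
pose A n := [set x | `|phi x| <= n%:R].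
have mA n : measurable (A n).
  rewrite /A -[X in measurable X]setTI; apply: measurable_fun_le => //.
  exact: measurableT_comp.
apply: null_sqr.
have lim1 : \int[m w]_x \1_(A n) x @[n --> \oo] --> \int[m w]_x (cst 1 x).
  apply: (Rintegral_dominated_cvg (g := cst 1)).
  - by move=> n; exact: measurable_indic.
  - move=> x; apply: cvg_near_cst; near=> n; rewrite indicE mem_set//.
    by rewrite /A /=; near: n; exact: nbhs_infty_ger.
  - exact: (Lfun2_integrable (Lfun2_cst S 1 w)).
  - by move=> n x; rewrite indicE; case: (_ \in _); rewrite /= ?normr1 ?normr0.
have lim0 : \int[m w]_x \1_(A n) x @[n --> \oo] --> (0 : R).
  rewrite (_ : (fun n => _) = cst 0); first exact: cvg_cst.
  apply/funext => n; rewrite (Rintegral_indic_smeas S w (mA n)) ipC; apply: w0.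
  apply: (@calc_dom _ _ (\int[m w]_x (cst (n%:R ^+ 2) x))) => // l ml l_le.
  have := step_op_calc_dist (calc_proj w (mA n))
    (calc_step w (@measurable_step0 _ T R)) ml.
  rewrite {2 4}/step_op big_nil subr0 step_op_sqr// => ->.
  apply: le_Rintegral => //.
  - rewrite (_ : EFin \o _ = EFin \o (fun x => (step_fun l x * \1_(A n) x) ^+ 2)).
      apply: Lfun2_integrable_sqr; apply: (Lfun2_le _ (step_Lfun2 S w ml)).
        by apply: measurable_funM; [exact: step_fun_measurable|exact: measurable_indic].
      move=> x; rewrite normrM ler_piMr// indicE.
      by case: (_ \in _); rewrite /= ?normr1 ?normr0.
    by apply/funext => x /=; rewrite [step_fun [::] x]big_nil subr0.
  - exact: (Lfun2_integrable (Lfun2_cst S _ w)).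
  - move=> x _; rewrite [step_fun [::] x]big_nil subr0 indicE /=.
    have [xA|_] := boolP (x \in A n); last by rewrite mulr0 expr0n exprn_ge0.
    rewrite mulr1 -(real_normK (num_real (step_fun l x))) lerXn2r ?nnegrE//.
    by apply: le_trans (l_le x) _; move: xA; rewrite inE.
have := cvg_unique _ lim1 lim0.
by rewrite Rintegral_cst// mul1r smeas_setT; apply.
Unshelve. all: by end_near. Qed.

Lemma calc_of_polar phi u w : phi \in Lfun (m u) 2%:E ->
  (forall v, phi \in Lfun (m v) 2%:E -> h w v = polar phi u v) -> calc S phi u w.
Proof.
move=> phi2 wp; have [z cz] := calc_exists phi2.
apply: (calc_null cz); apply: (calc_dom_dense (Lfun2_measurable phi2)) => v v2.
by rewrite ipBl (calc_polar cz v2) wp// subrr.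
Qed.

Lemma calc_sym phi u v w y : calc S phi u w -> calc S phi v y -> h w v = h u y.
Proof.
move=> cw cy; have mphi := Lfun2_measurable cw.1.
have [l [ml l_le l_phi]] := step_approximation mphi.
have lim1 := @tends_ip _ _ _ _ _ v (calc_tends cw ml l_le l_phi).
have lim2 := @tends_ip _ _ _ _ _ u (calc_tends cy ml l_le l_phi).
rewrite (ipC h u); apply: (cvg_unique _ lim1) => //.
move: lim2; apply: cvg_trans; apply: near_eq_cvg; apply: nearW => n /=.
by rewrite step_op_sym// ipC.
Qed.

Lemma calc_nulll phi u v w : calc S phi u w -> null h (u - v) -> calc S phi v w.
Proof.
move=> cw uv; have mphi := Lfun2_measurable cw.1.
have v2 : phi \in Lfun (m v) 2%:E.
  apply: (@calc_dom _ _ (\int[m u]_x (phi x) ^+ 2)) => // l ml l_le.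
  rewrite -step_op_sqr// -nrm_sqr -(null_nrm (null_step_op ml uv)) nrm_sqr.
  exact: Lfun2_smeas_le cw.1 ml l_le.
have [z cz] := calc_exists v2; apply: (calc_null cz).
have [l [ml l_le l_phi]] := step_approximation mphi.
apply: (tends_unique (calc_tends cz ml l_le l_phi)).
move: (calc_tends cw ml l_le l_phi).
apply: cvg_trans; apply: near_eq_cvg; apply: nearW => n /=.
apply: null_nrm; apply: nullP => x; rewrite !ipBl.
have := null_ip x (null_step_op (ml n) uv); rewrite ipBl; lra.
Qed.

End spectral_calculus_theory.

(** * Positive operators *)

(** A symmetric operator with graph [gr] and the square root of it that
    the estimates need: [hd] is the domain D(L^(1/2)) and [en u] is
    [|L^(1/2) u|]. *)
Record energy_operator (R : realType) (V : lmodType R) (h : hilbert_form V) :=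
  EnergyOperator {
  gr : V -> V -> Prop;
  hd : V -> Prop;
  en : V -> R;
  gr_linear : forall a u v w y, gr u w -> gr v y ->
    gr (a *: u + v) (a *: w + y);
  gr_null : forall u u' w w', gr u w -> null h (u - u') -> null h (w - w') ->
    gr u' w';
  gr_unique : forall u w w', gr u w -> gr u w' -> null h (w - w');
  gr_sym : forall u v w y, gr u w -> gr v y -> h w v = h u y;
  gr_resolvent : forall c g, 0 < c ->
    exists v w, gr v w /\ null h (v + c *: w - g);
  hd_linear : forall a u v, hd u -> hd v -> hd (a *: u + v);
  hd_null : forall u v, hd u -> null h (u - v) -> hd v /\ en v = en u;
  en_ge0 : forall u, 0 <= en u;
  enD : forall u v, hd u -> hd v -> en (u + v) <= en u + en v;
  enZ : forall a u, hd u -> en (a *: u) = `|a| * en u;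
  gr_hd : forall u w, gr u w -> hd u /\ en u ^+ 2 = h w u }.

Section positive_spectral_family.
Context (R : realType) (V : lmodType R) (h : hilbert_form V).
Variable S : spectral_family (measurableTypeR R) h.
Local Notation m := (smeas S).
Hypothesis S_ge0 : forall u w, calc S id u w -> 0 <= h w u.

(** Positivity at the vector [E(A) u], for a bounded [A] in the negative half line,
    reads [0 <= int_A x dm_u(x)], which forces [m_u(A) = 0]. *)
Lemma smeas_ae_ge0 u : {ae m u, forall x : measurableTypeR R, 0 <= (x : R)}.
Proof.
have ae_n (n : nat) : {ae m u, forall x : measurableTypeR R, ~ (- n%:R <= (x : R) < 0)}.
  pose A := [set` `[- n%:R, 0 : R[].
  have mA : measurable (A : set (measurableTypeR R)) by exact: measurable_itv.
  have inA x : x \in A = (- n%:R <= x < 0) by rewrite mem_setE in_itv.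
  pose f (x : measurableTypeR R) : R := x * \1_A x.
  have mf : measurable_fun setT f.
    by apply: measurable_funM => //; exact: measurable_indic.
  have f_le0 x : f x <= 0.
    rewrite /f indicE; case: (boolP (x \in A)); last by rewrite mulr0.
    by rewrite inA mulr1 => /andP[_ /ltW].
  have f2 : f \in Lfun (m u) 2%:E.
    apply: (@bounded_Lfun2 _ _ _ _ _ _ _ n%:R) => // x.
    rewrite /f indicE; case: (boolP (x \in A)); last by rewrite mulr0 normr0.
    by rewrite inA mulr1 => /andP[x1 x2]; rewrite ltr0_norm// lerNl.
  have [y cy] := calc_exists f2.
  have Lp : calc S id (sproj S A u) y by apply: (calc_comp (calc_proj S u mA)).
  have m1A := @measurable_step1 _ _ _ (1 : R) _ mA.
  have := S_ge0 Lp.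
  have -> : sproj S A u = step_op S [:: (1, A)] u.
    by rewrite /step_op big_seq1 scale1r.
  rewrite (calc_ip_step cy m1A).
  have -> : \int[m u]_x (f x * step_fun [:: (1, A)] x) = \int[m u]_x f x.
    apply: eq_Rintegral => x _; rewrite step_fun1 mul1r /f indicE.
    by case: (x \in A); rewrite ?mulr1 ?mulr0.
  move=> int_ge0.
  have if2 := Lfun2_integrable f2.
  have abs0 : \int[m u]_x `|f x| = 0.
    apply/eqP; rewrite eq_le Rintegral_ge0// andbT.
    under eq_Rintegral => x _ do rewrite ler0_norm// -mulN1r.
    by rewrite RintegralZl// mulN1r oppr_le0.
  have ae0 : ae_eq (m u) setT (EFin \o f) (cst 0%E).
    apply/(ae_eq_integral_abs (m u) measurableT); first exact/measurable_EFinP.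
    rewrite -[RHS]/(0%:E) -abs0 /Rintegral fineK//.
    by apply: integrable_fin_num => //; exact: integrable_abse if2.
  apply: filterS ae0 => x /= fx0 /andP[x1 x2].
  have := fx0 I => -[]; rewrite /f indicE (_ : x \in A) ?inA ?x1// mulr1 => x0.
  by rewrite x0 ltxx in x2.
apply: filterS (ae_foralln ae_n) => x xn; rewrite leNgt; apply/negP => x0.
apply: (xn (Num.truncn (- x)).+1); rewrite x0 andbT lerNl ltW//.
exact: truncnS_gt.
Qed.

Local Notation sq := (Num.sqrt : measurableTypeR R -> R).

Definition energy u : R := Num.sqrt (\int[m u]_x (sq x) ^+ 2).

Lemma energy_nrm u z : calc S sq u z -> energy u = nrm h z.
Proof. by move=> cz; rewrite /energy -(calc_sqr cz). Qed.

Lemma sqrt_measurable : measurable_fun setT sq.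
Proof. by apply: continuous_measurable_fun; exact: sqrt_continuous. Qed.

Lemma calc_id_sqrt u w : calc S id u w ->
  sq \in Lfun (m u) 2%:E /\ energy u ^+ 2 = h w u.
Proof.
move=> cw; have id2 := cw.1.
have abs2 : (fun x : measurableTypeR R => `|x|) \in Lfun (m u) 2%:E.
  apply: (Lfun2_le _ id2); last by move=> x; rewrite normr_id.
  exact: measurableT_comp.
have sq2 : sq \in Lfun (m u) 2%:E.
  apply: (Lfun2_le sqrt_measurable (Lfun2D (Lfun2_cst S 1 u) abs2)) => x.
  have x1 : 0 <= 1 + `|x| by rewrite addr_ge0.
  rewrite /= (ger0_norm x1) ger0_norm ?sqrtr_ge0//.
  have [x0|x0] := leP 0 x; last by rewrite ltr0_sqrtr.
  rewrite -ler_sqr ?nnegrE ?sqrtr_ge0// sqr_sqrtr// ger0_norm//.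
  by nra.
split=> //; rewrite /energy sqr_sqrtr; last first.
  by apply: Rintegral_ge0 => x _; exact: sqr_ge0.
rewrite (calc_ip_self cw); apply: ae_eq_Rintegral => //.
  by apply: measurable_funX; exact: sqrt_measurable.
by apply: filterS (smeas_ae_ge0 u) => x x0; rewrite sqr_sqrtr.
Qed.

(** With [phi x = (1 + c x)^-1], the function [(1 - phi) / c] is [x phi] on the
    spectrum, which is the value of [L] at [phi(L) g]. The maximum with 0 keeps
    [phi] bounded off the spectrum. *)
Lemma calc_resolvent c g : 0 < c ->
  exists v w, calc S id v w /\ null h (v + c *: w - g).
Proof.
move=> c0; pose phi (x : measurableTypeR R) : R := (1 + c * Num.max x 0)^-1.
have den x : 1 <= 1 + c * Num.max x 0.
  by rewrite lerDl mulr_ge0 ?(ltW c0)// le_max lexx orbT.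
have mphi : measurable_fun setT phi.
  apply: continuous_measurable_fun => x; apply: cvgV.
    by rewrite gt_eqF// (lt_le_trans ltr01).
  apply: cvgD; first exact: cvg_cst.
  apply: cvgM; first exact: cvg_cst.
  by apply: (@continuous_max _ _ id (cst 0)); [exact: cvg_id|exact: cvg_cst].
have [v cv] : exists v, calc S phi g v.
  apply: calc_exists; apply: (@bounded_Lfun2 _ _ _ _ _ _ _ 1) => // x.
  rewrite /phi ger0_norm ?invr_ge0 ?(le_trans ler01)//.
  by rewrite invf_le1// (lt_le_trans ltr01).
exists v, (c^-1 *: (g - v)); split; last first.
  rewrite scalerA mulfV ?gt_eqF// scale1r addrCA subrr addr0 subrr; exact: null0.
apply: (calc_comp cv) => //.
apply: (calc_ae (calc_compl (lt0r_neq0 c0) cv)).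
  by apply: measurable_funM.
apply: filterS (smeas_ae_ge0 g) => x x0; rewrite /phi (max_idPl x0).
have := den x; rewrite (max_idPl x0) => /(lt_le_trans ltr01)/lt0r_neq0 d0.
by field; rewrite d0 gt_eqF.
Qed.

Lemma energy_ge0 u : 0 <= energy u. Proof. exact: sqrtr_ge0. Qed.

Lemma energyZ a u : sq \in Lfun (m u) 2%:E -> energy (a *: u) = `|a| * energy u.
Proof.
move=> /calc_exists[z cz].
have c0 : calc S sq 0 0.
  by have := calc_linear (-1) cz cz; rewrite !scaleN1r !addNr.
have := calc_linear a cz c0; rewrite !addr0 => caz.
by rewrite (energy_nrm caz) (energy_nrm cz) nrmZ.
Qed.

Lemma energyD u v : sq \in Lfun (m u) 2%:E -> sq \in Lfun (m v) 2%:E ->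
  energy (u + v) <= energy u + energy v.
Proof.
move=> /calc_exists[z cz] /calc_exists[y cy].
have := calc_linear 1 cz cy; rewrite !scale1r => czy.
by rewrite (energy_nrm czy) (energy_nrm cz) (energy_nrm cy) nrmD.
Qed.

Lemma energy_null u v : sq \in Lfun (m u) 2%:E -> null h (u - v) ->
  sq \in Lfun (m v) 2%:E /\ energy v = energy u.
Proof.
move=> /calc_exists[z cz] uv; have cz' := calc_nulll cz uv.
by split; [exact: cz'.1|rewrite (energy_nrm cz) (energy_nrm cz')].
Qed.

Definition spectral_energy_operator : energy_operator h :=
  @EnergyOperator R V h (calc S id) (fun u => sq \in Lfun (m u) 2%:E) energy
    (fun a u v w y cu cv => calc_linear a cu cv)
    (fun u u' w w' cu uu ww => calc_null (calc_nulll cu uu) ww)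
    (@calc_unique _ _ _ _ _ _ _)
    (@calc_sym _ _ _ _ _ _ _)
    calc_resolvent
    (@calc_dom_linear _ _ _ _ _ _ _)
    energy_null energy_ge0 energyD energyZ calc_id_sqrt.

End positive_spectral_family.

(** * Resolvent estimates *)

Section resolvent_estimates.
Context (R : realType) (V : lmodType R) (h : hilbert_form V).
Variable A : energy_operator h.
Implicit Types (u v w y z g : V) (c : R).

Lemma gr_ge0 u w : gr A u w -> 0 <= h w u.
Proof. by move=> /gr_hd[_ <-]; exact: sqr_ge0. Qed.

Lemma gr_sub u w v y : gr A u w -> gr A v y -> gr A (u - v) (w - y).
Proof.
move=> uw vy; have := gr_linear (-1) vy uw.
by rewrite !scaleN1r addrC (addrC (- y)).
Qed.

Lemma hd_sub u v : hd A u -> hd A v -> hd A (u - v).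
Proof. by move=> hu hv; have := hd_linear (-1) hv hu; rewrite scaleN1r addrC. Qed.

Lemma hdD u v : hd A u -> hd A v -> hd A (u + v).
Proof. by move=> hu hv; have := hd_linear 1 hu hv; rewrite scale1r. Qed.

Lemma hd0 u : hd A u -> hd A 0.
Proof. by move=> hu; rewrite -(subrr u); exact: hd_sub. Qed.

Lemma hdZ c u : hd A u -> hd A (c *: u).
Proof. by move=> hu; have := hd_linear c hu (hd0 hu); rewrite addr0. Qed.

Lemma enB u v : hd A u -> hd A v -> en A (u - v) <= en A u + en A v.
Proof.
move=> hu hv; rewrite -scaleN1r; apply: le_trans (enD hu (hdZ _ hv)) _.
by rewrite enZ// normrN1 mul1r.
Qed.

(** [4 c (y, z) <= |z + c y|^2], as the difference is [|z - c y|^2]. *)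
Lemma resolvent_en z y c : 0 < c -> gr A z y ->
  en A z <= nrm h (z + c *: y) / (2 * Num.sqrt c).
Proof.
move=> c0 zy; have [_ e2] := gr_hd zy.
have s0 : 0 < Num.sqrt c by rewrite sqrtr_gt0.
rewrite ler_pdivlMr ?mulr_gt0//.
have c0' := ltW c0.
rewrite -ler_sqr ?nnegrE ?nrm_ge0 ?mulr_ge0 ?en_ge0 ?sqrtr_ge0//.
rewrite nrm_sqr !exprMn sqr_sqrtr// e2 !ipE (ipC h z y).
have := ip_ge0 h (z - c *: y); rewrite !ipE (ipC h z y); lra.
Qed.

Lemma resolvent_op z y c : 0 < c -> gr A z y ->
  nrm h y <= nrm h (z + c *: y) / c.
Proof.
move=> c0 zy; rewrite ler_pdivlMr//.
have c0' := ltW c0.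
rewrite -ler_sqr ?nnegrE ?nrm_ge0 ?mulr_ge0 ?nrm_ge0//.
rewrite exprMn !nrm_sqr !ipE (ipC h z y).
have := gr_ge0 zy; have := ip_ge0 h z.
move=> z0 yz; have := mulr_ge0 c0' yz; lra.
Qed.

(** The resolvent commutes with [L]: as [c y = u - z] lies in the domain, [y] solves
    the same equation with [a = L u] on the right. *)
Lemma resolvent_regular u a z y c : 0 < c -> gr A u a -> gr A z y ->
  null h (z + c *: y - u) -> nrm h y <= nrm h a /\ en A z <= en A u.
Proof.
move=> c0 ua zy zu; have cN0 := lt0r_neq0 c0.
pose b := c^-1 *: (a - y).
have yb : gr A y b.
  have h0 := gr_sub ua zy; have := gr_linear c^-1 h0 (gr_sub h0 h0).
  rewrite !subrr !addr0 => /gr_null; apply; last first.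
    by rewrite subrr; exact: null0.
  apply: nullP => x; have := null_ip x zu; rewrite !ipE => /eqP.
  rewrite subr_eq0 => /eqP<-; by field.
have ea : a = y + c *: b by rewrite /b scalerA mulfV// scale1r addrC subrK.
clearbody b; have by0 := gr_ge0 yb; have bz : h b z = h y y := gr_sym yb zy.
have cb0 := mulr_ge0 (ltW c0) by0.
split.
  rewrite -ler_sqr ?nnegrE ?nrm_ge0// !nrm_sqr ea !ipE (ipC h y b).
  have := mulr_ge0 (ltW c0) (mulr_ge0 (ltW c0) (ip_ge0 h b)); lra.
rewrite -ler_sqr ?nnegrE ?en_ge0//.
have [_ ->] := gr_hd ua; have [_ ->] := gr_hd zy.
rewrite (ipC h a u) -(null_ipl _ zu) (ipC h _ a) ea !ipE bz.
have yy := mulr_ge0 (ltW c0) (ip_ge0 h y).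
have := mulr_ge0 (ltW c0) cb0; lra.
Qed.

(** The solution is the sum of those for [F] and for [u]; smoothing is used for the
    first and regularity of the data for the second. *)
Lemma resolvent_bounds u a F v y c : 0 < c -> gr A u a -> gr A v y ->
  null h (v + c *: y - (F + u)) ->
  en A v <= nrm h F / (2 * Num.sqrt c) + en A u /\
  nrm h y <= nrm h F / c + nrm h a.
Proof.
move=> c0 ua vy vFu.
have [v1 [y1 [vy1 v1F]]] := gr_resolvent A F c0.
have vy2 := gr_sub vy vy1.
have v2u : null h (v - v1 + c *: (y - y1) - u).
  apply: nullP => x; have := null_ip x vFu; have := null_ip x v1F.
  rewrite !ipE; lra.
have [yb eb] := resolvent_regular c0 ua vy2 v2u.
have e1 := resolvent_en c0 vy1; have o1 := resolvent_op c0 vy1.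
rewrite (null_nrm v1F) in e1 o1.
have [h1 _] := gr_hd vy1; have [h2 _] := gr_hd vy2.
split.
  rewrite -(subrK v1 v) addrC; apply: le_trans (enD h1 h2) _; exact: lerD.
rewrite -(subrK y1 y) addrC; apply: le_trans (nrmD _ _ _) _; exact: lerD.
Qed.

(** The difference [z] solves [z + c L z = (c' - c) y']. *)
Lemma resolvent_lipschitz g v y v' y' c c' : 0 < c -> gr A v y -> gr A v' y' ->
  null h (v + c *: y - g) -> null h (v' + c' *: y' - g) ->
  en A (v - v') <= `|c - c'| * nrm h y' / (2 * Num.sqrt c).
Proof.
move=> c0 vy vy' vg vg'.
have := resolvent_en c0 (gr_sub vy vy').
rewrite (@null_nrm _ _ _ _ ((c' - c) *: y')) ?nrmZ ?(distrC c')//.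
apply: nullP => x; have := null_ip x vg; have := null_ip x vg'.
rewrite !ipE; lra.
Qed.

End resolvent_estimates.

(** * One implicit step *)

Lemma contraction_fixpoint_ge (R : realType) (s0 rho : R) (f : R -> R) :
  0 <= rho < 1 -> (forall s, s0 <= s -> s0 <= f s) ->
  (forall s t, s0 <= s -> s0 <= t -> `|f s - f t| <= rho * `|s - t|) ->
  exists2 s, s0 <= s & s = f s.
Proof.
move=> /andP[rho0 rho1] f_ge f_lip.
pose U : set R := [set s | s0 <= s].
have fU : {homo f : x / U x >-> U x} by move=> s; exact: f_ge.
have [//|||s Us sf] := @banach_fixed_point R R U (mkfun fU).
- exists (NngNum rho0); split=> // -[s t] [/= Us Ut]; exact: f_lip.
- exact: closed_ge.
- by exists s0; rewrite /U /=.
by exists s.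
Qed.

Section kirchhoff_step.
Context (R : realType) (V : lmodType R) (h : hilbert_form V).
Variables (A : energy_operator h) (tau al be : R) (um uk F : V).
Implicit Types (u v w x y z : V).

(** The letters stand for the data of one level: [um], [uk] and [F] are u_(k-1),
    u_k and f_k, [al] and [be] the values of alpha and beta. The trial vector
    [x] fixes the coefficient, [v] is the unknown. *)
Definition step_coef x : R :=
  al + be / 2 * (en A (2 *: x - um) ^+ 2 + en A um ^+ 2).

Definition step_eq x v : Prop :=
  exists2 y, gr A v y &
    null h (v + (tau ^+ 2 / 2 * step_coef x) *: y - ((tau ^+ 2 / 2) *: F + uk)).

Variables (al0 bm K2 K4 K5 K6 : R) (a : V).
Hypotheses (tau_gt0 : 0 < tau) (al0_gt0 : 0 < al0) (al0_le : al0 <= al).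
Hypotheses (be0 : 0 <= be) (be_le : be <= bm).
Hypotheses (um_hd : hd A um) (um_en : en A um <= K2).
Hypotheses (uk_gr : gr A uk a) (uk_en : en A uk <= K2) (a_le : nrm h a <= K4).
Hypothesis K5_ge : tau / (2 * Num.sqrt (2 * al0)) * nrm h F + K2 <= K5.
Hypothesis K6_ge : (Num.sqrt (2 * al0))^-1 * (al0^-1 * nrm h F + K4) <= K6.
Let K7 := K2 + 2 * K5.
Let rho := tau * (K7 * K6 * bm).
Let g := (tau ^+ 2 / 2) *: F + uk.
Let s0 := tau ^+ 2 / 2 * al0.

Let K2_ge0 : 0 <= K2. Proof. exact: le_trans (en_ge0 _ _) um_en. Qed.

Let K5_ge0 : 0 <= K5.
Proof.
apply: le_trans K5_ge; rewrite addr_ge0// mulr_ge0 ?nrm_ge0//.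
by rewrite divr_ge0 ?mulr_ge0 ?sqrtr_ge0 ?(ltW tau_gt0).
Qed.

Let K4_ge0 : 0 <= K4. Proof. exact: le_trans (nrm_ge0 _ _) a_le. Qed.

Let K6_ge0 : 0 <= K6.
Proof.
apply: le_trans K6_ge; rewrite mulr_ge0 ?invr_ge0 ?sqrtr_ge0// addr_ge0//.
by rewrite mulr_ge0 ?nrm_ge0// invr_ge0 ltW.
Qed.

Let K7_ge0 : 0 <= K7. Proof. by rewrite addr_ge0// mulr_ge0. Qed.

Let bm_ge0 : 0 <= bm. Proof. exact: le_trans be_le. Qed.

Let rho_ge0 : 0 <= rho.
Proof. by rewrite mulr_ge0 ?(ltW tau_gt0)// !mulr_ge0. Qed.

Let t2 : 0 < tau ^+ 2 / 2. Proof. by rewrite divr_gt0// exprn_gt0. Qed.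

Let s0_gt0 : 0 < s0. Proof. by rewrite mulr_gt0. Qed.

Lemma step_coef_ge x : al0 <= step_coef x.
Proof.
apply: le_trans al0_le _; rewrite lerDl mulr_ge0 ?divr_ge0//.
by rewrite addr_ge0// sqr_ge0.
Qed.

Let coef_ge x : s0 <= tau ^+ 2 / 2 * step_coef x.
Proof. by rewrite ler_wpM2l ?(ltW t2)// step_coef_ge. Qed.

(** Makes the factor [tau] appear in the smoothing estimates. *)
Let sqrt_s0 : 2 * Num.sqrt s0 = tau * Num.sqrt (2 * al0).
Proof.
have -> : s0 = (tau / 2) ^+ 2 * (2 * al0) by rewrite /s0; field.
rewrite sqrtrM ?sqr_ge0// sqrtr_sqr ger0_norm; first by field.
by rewrite divr_ge0// ltW.
Qed.

Let sqrt_gt0 : 0 < Num.sqrt (2 * al0).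
Proof. by rewrite sqrtr_gt0 mulr_gt0. Qed.

Let sqrt_le s : s0 <= s -> (2 * Num.sqrt s)^-1 <= (tau * Num.sqrt (2 * al0))^-1.
Proof.
move=> s0s; rewrite -sqrt_s0 lef_pV2 ?posrE ?mulr_gt0 ?sqrtr_gt0//.
  by rewrite ler_wpM2l// ler_wsqrtr.
exact: lt_le_trans s0s.
Qed.

Section frozen_coefficient.
Variables (s : R) (v y : V).
Hypotheses (s_ge : s0 <= s) (vy : gr A v y) (vg : null h (v + s *: y - g)).

Let s_gt0 : 0 < s. Proof. exact: lt_le_trans s_ge. Qed.

Lemma frozen_en : en A v <= K5.
Proof.
have [+ _] := resolvent_bounds s_gt0 uk_gr vy vg; move/le_trans; apply.
apply: le_trans K5_ge; apply: lerD => //.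
rewrite nrmZ (ger0_norm (ltW t2)).
apply: le_trans (ler_wpM2l _ (sqrt_le s_ge)) _.
  by rewrite mulr_ge0 ?nrm_ge0 ?(ltW t2).
rewrite le_eqVlt; apply/orP; left; apply/eqP; field.
by rewrite !gt_eqF.
Qed.

Lemma frozen_op : nrm h y <= Num.sqrt (2 * al0) * K6.
Proof.
have [_ y_le] := resolvent_bounds s_gt0 uk_gr vy vg.
rewrite -ler_pdivrMl//; apply: le_trans K6_ge.
rewrite ler_wpM2l ?invr_ge0 ?sqrtr_ge0//; apply: le_trans y_le _.
apply: lerD => //; rewrite nrmZ (ger0_norm (ltW t2)) mulrAC ler_wpM2r ?nrm_ge0//.
rewrite ler_pdivrMr// ler_pdivlMl//. by rewrite mulrC.
Qed.

End frozen_coefficient.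

Let frozen_lipschitz s t v y w z : s0 <= s -> s0 <= t ->
  gr A v y -> gr A w z -> null h (v + s *: y - g) -> null h (w + t *: z - g) ->
  en A (v - w) <= `|s - t| * (K6 / tau).
Proof.
move=> ss st vy wz vg wg.
have sgt0 : 0 < s by exact: lt_le_trans ss.
apply: le_trans (resolvent_lipschitz sgt0 vy wz vg wg) _.
rewrite -mulrA ler_wpM2l//.
apply: (@le_trans _ _ (Num.sqrt (2 * al0) * K6 * (tau * Num.sqrt (2 * al0))^-1)).
  apply: ler_pM; rewrite ?nrm_ge0 ?invr_ge0 ?mulr_ge0 ?sqrtr_ge0//.
    exact: frozen_op st wz wg.
  exact: sqrt_le.
rewrite le_eqVlt; apply/orP; left; apply/eqP; field.
by rewrite !gt_eqF.
Qed.

Let trial_en x : hd A x -> en A x <= K5 -> en A (2 *: x - um) <= K7.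
Proof.
move=> hx xK; apply: le_trans (enB (hdZ _ hx) um_hd) _.
by rewrite enZ// ger0_norm// /K7 addrC lerD// ler_wpM2l.
Qed.

(** [p^2 - q^2 = (p - q) (p + q)], where [|p - q| <= 2 |L^(1/2) (x - x')|] and
    [p + q <= 2 K7]. *)
Let coef_lipschitz x x' : hd A x -> hd A x' ->
  en A (2 *: x - um) <= K7 -> en A (2 *: x' - um) <= K7 ->
  `|tau ^+ 2 / 2 * step_coef x - tau ^+ 2 / 2 * step_coef x'| <=
  tau ^+ 2 * bm * K7 * en A (x - x').
Proof.
move=> hx hx' xK xK'.
set p := en A (2 *: x - um) in xK *; set q := en A (2 *: x' - um) in xK' *.
have p0 : 0 <= p := en_ge0 _ _; have q0 : 0 <= q := en_ge0 _ _.
set e := en A (x - x'); have e0 : 0 <= e := en_ge0 _ _.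
have hp := hd_sub (hdZ 2 hx) um_hd; have hq := hd_sub (hdZ 2 hx') um_hd.
have e2 : en A (2 *: (x - x')) = 2 * e.
  by rewrite enZ ?ger0_norm//; exact: hd_sub.
have hd2 : hd A (2 *: (x - x')) by apply: hdZ; exact: hd_sub.
have pq : p <= q + 2 * e.
  rewrite -e2; have := enD hq hd2.
  rewrite (_ : 2 *: x' - um + _ = 2 *: x - um)//.
  by rewrite scalerBr addrAC addrCA subrr addr0.
have qp : q <= p + 2 * e.
  rewrite -e2; have := enB hp hd2.
  rewrite (_ : 2 *: x - um - _ = 2 *: x' - um)//.
  by rewrite scalerBr opprB addrAC addrCA subrr addr0.
have -> : tau ^+ 2 / 2 * step_coef x - tau ^+ 2 / 2 * step_coef x' =
    tau ^+ 2 / 4 * be * ((p - q) * (p + q)) by rewrite /step_coef -/p -/q; field.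
have tb : 0 <= tau ^+ 2 / 4 * be by rewrite mulr_ge0// divr_ge0// sqr_ge0.
rewrite normrM (ger0_norm tb) normrM (ger0_norm (addr_ge0 p0 q0)).
apply: (@le_trans _ _ (tau ^+ 2 / 4 * be * (2 * e * (2 * K7)))).
  rewrite ler_wpM2l// ler_pM ?addr_ge0//; last by lra.
  by rewrite ler_norml; lra.
have -> : tau ^+ 2 / 4 * be * (2 * e * (2 * K7)) = be * (tau ^+ 2 * K7 * e).
  by field.
have -> : tau ^+ 2 * bm * K7 * e = bm * (tau ^+ 2 * K7 * e) by ring.
apply: ler_wpM2r => //; apply: mulr_ge0 => //; apply: mulr_ge0 => //.
exact: sqr_ge0.
Qed.

Lemma step_eq_hd x v : step_eq x v -> hd A v.
Proof. by case=> y /gr_hd[]. Qed.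

Lemma step_eq_trial x v : step_eq x v -> en A (2 *: v - um) <= K7.
Proof.
case=> y vy vg; apply: trial_en; first by have [] := gr_hd vy.
exact: frozen_en (coef_ge x) vy vg.
Qed.

Lemma step_contraction x x' v v' : hd A x -> hd A x' ->
  en A (2 *: x - um) <= K7 -> en A (2 *: x' - um) <= K7 ->
  step_eq x v -> step_eq x' v' -> en A (v - v') <= rho * en A (x - x').
Proof.
move=> hx hx' xK xK' [y vy vg] [y' vy' vg'].
apply: le_trans (frozen_lipschitz (coef_ge x) (coef_ge x') vy vy' vg vg') _.
apply: le_trans (ler_wpM2r _ (coef_lipschitz hx hx' xK xK')) _.
  by rewrite divr_ge0// ltW.
rewrite le_eqVlt; apply/orP; left; apply/eqP; rewrite /rho; field.
by rewrite gt_eqF.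
Qed.

Lemma step_eq_solvable x : exists v, step_eq x v.
Proof.
have c0 : 0 < tau ^+ 2 / 2 * step_coef x by exact: lt_le_trans (coef_ge x).
by have [v [y [vy vg]]] := gr_resolvent A g c0; exists v, y.
Qed.

(** The equation depends on its unknown through a real number only, so that the
    fixed point is sought on a half line of coefficients. *)
Lemma step_exists : rho < 1 -> exists v, step_eq v v.
Proof.
move=> rho1.
have /choice[Vs HVs] s : exists p : V * V, s0 <= s ->
    gr A p.1 p.2 /\ null h (p.1 + s *: p.2 - g).
  have [s0s|_] := boolP (s0 <= s); last by exists (0, 0).
  have [v [y [vy vg]]] := gr_resolvent A g (lt_le_trans s0_gt0 s0s).
  by exists (v, y).
pose f s := tau ^+ 2 / 2 * step_coef (Vs s).1.
have [|||s s0s sf] := @contraction_fixpoint_ge _ s0 rho f.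
- by rewrite rho_ge0.
- by move=> s _; exact: coef_ge.
- move=> s t ss st; have [vy vg] := HVs _ ss; have [wz wg] := HVs _ st.
  have [hv _] := gr_hd vy; have [hw _] := gr_hd wz.
  have vK := trial_en hv (frozen_en ss vy vg).
  have wK := trial_en hw (frozen_en st wz wg).
  apply: le_trans (coef_lipschitz hv hw vK wK) _.
  apply: le_trans (ler_wpM2l _ (frozen_lipschitz ss st vy wz vg wg)) _.
    by apply: mulr_ge0 => //; apply: mulr_ge0 => //; exact: sqr_ge0.
  rewrite le_eqVlt; apply/orP; left; apply/eqP; rewrite /rho; field.
  by rewrite gt_eqF.
exists (Vs s).1; have [vy vg] := HVs _ s0s.
by exists (Vs s).2 => //; rewrite -[_ * step_coef _]/(f s) -sf.
Qed.

Lemma step_unique v v' : rho < 1 -> step_eq v v -> step_eq v' v' ->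
  null h (v - v').
Proof.
move=> rho1 vv vv'.
have hv := step_eq_hd vv; have hv' := step_eq_hd vv'.
have vK := step_eq_trial vv; have vK' := step_eq_trial vv'.
have e0 : en A (v - v') = 0.
  apply/eqP; rewrite eq_le en_ge0 andbT.
  have := step_contraction hv hv' vK vK' vv vv'.
  rewrite -subr_ge0 -[X in _ - X]mul1r -mulrBl.
  by rewrite nmulr_rge0// subr_lt0.
have [y vy vg] := vv; have [y' vy' vg'] := vv'.
have := coef_lipschitz hv hv' vK vK'; rewrite e0 mulr0 normr_le0 subr_eq0.
move=> /eqP ec.
have zy := gr_sub vy vy'; rewrite -ec in vg'.
have zg : null h (v - v' + (tau ^+ 2 / 2 * step_coef v) *: (y - y')).
  apply: nullP => x; have := null_ip x vg; have := null_ip x vg'.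
  rewrite !ipE; lra.
have c0 : 0 < tau ^+ 2 / 2 * step_coef v by exact: lt_le_trans (coef_ge v).
have y0 : null h (y - y').
  apply/eqP; rewrite eq_le nrm_ge0 andbT.
  by have := resolvent_op c0 zy; rewrite zg mul0r.
apply: nullP => x; have := null_ip x zg; rewrite ipDl ipZl (null_ip x y0).
by rewrite mulr0 addr0.
Qed.

End kirchhoff_step.

(** * The Dirichlet Laplacian on L2(Omega) *)

Section L2_hilbert.
Context (R : realType) (Om : bounded_convex_domain R).
Implicit Types u v w : L2 Om.

Lemma L2_Lfun u : (u : _ -> R) \in Lfun (area Om) 2%:E.
Proof. exact: LfunP. Qed.

Lemma L2inner_linearl a u v x :
  L2inner (a *: u + v) x = a * L2inner u x + L2inner v x.
Proof. exact: RintegralDl (L2_Lfun u) (L2_Lfun v) (L2_Lfun x). Qed.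

Lemma L2innerC u v : L2inner u v = L2inner v u.
Proof. by apply: eq_Rintegral => z _; rewrite mulrC. Qed.

Lemma L2inner_ge0 u : 0 <= L2inner u u.
Proof. by apply: Rintegral_ge0 => z _; rewrite -expr2 sqr_ge0. Qed.

Lemma L2_complete (z : nat -> L2 Om) :
  (forall e, 0 < e -> exists N, forall m n, (N <= m)%N -> (N <= n)%N ->
     L2inner (z m - z n) (z m - z n) <= e) ->
  exists w, forall e, 0 < e ->
    exists N, forall n, (N <= n)%N -> L2inner (w - z n) (w - z n) <= e.
Proof.
move=> cz.
have [|w w2 hw] := @Lfun2_complete _ _ _ (area Om) (fun n => z n) (fun n => L2_Lfun _).
  exact: cz.
by exists (Lfun_Sub (lee1n 2) w2).
Qed.

Definition L2_form : hilbert_form (L2 Om) :=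
  HilbertForm L2inner_linearl L2innerC L2inner_ge0 L2_complete.

Lemma L2normE u : L2norm u = nrm L2_form u.
Proof.
rewrite /L2norm unlock /=.
have -> : (\int[area Om]_x (`|(u x)%:E| `^ 2) = (L2inner u u)%:E)%E.
  rewrite (eq_integral (fun x => ((u x) ^+ 2)%:E)); last first.
    move=> x _; rewrite abse_EFin poweR_EFin powR_mulrn ?normr_ge0//.
    by rewrite real_normK ?num_real.
  rewrite Lfun2_sqr_EFin; last exact: L2_Lfun.
  by congr EFin; apply: eq_Rintegral => x _; rewrite expr2.
by rewrite poweR_EFin /= powR12_sqrt// L2inner_ge0.
Qed.

Lemma L2_subE u v z : (u - v : L2 Om) z = u z - v z.
Proof. by []. Qed.

Lemma L2eqP u v : u =L2 v <-> null L2_form (u - v).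
Proof.
split=> [uv|].
  apply: null_sqr; rewrite /= /L2inner.
  have -> : 0 = \int[area Om]_z (cst 0 z : R) by rewrite Rintegral_cst// mul0r.
  have m2 : measurable_fun setT (u - v : L2 Om).
    exact: Lfun2_measurable (L2_Lfun (u - v)).
  apply: ae_eq_Rintegral => //; first exact: measurable_funM.
  by apply: filterS uv => z /(_ I) uvz; rewrite L2_subE uvz subrr mulr0.
rewrite /null -L2normE => /fine_Lnormr_eq0.
by apply: filterS => z /(_ I)/eqP; rewrite L2_subE subr_eq0 => /eqP.
Qed.

End L2_hilbert.

Section laplacian_calculus.
Context (R : realType) (Om : bounded_convex_domain R).
Variable E : spectral_resolution Om.
Local Notation h := (L2_form Om).
Implicit Types u v w g : L2 Om.

Lemma spec_proj_linear A a u v x : measurable A ->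
  h (spec_proj E A (a *: u + v)) x =
  a * h (spec_proj E A u) x + h (spec_proj E A v) x.
Proof.
by move=> mA; rewrite (null_ipl _ ((L2eqP _ _).1 (spec_linear E a u v mA))) !ipE.
Qed.

Lemma spec_projT u x : h (spec_proj E setT u) x = h u x.
Proof. exact: null_ipl ((L2eqP _ _).1 (spec_setT E u)). Qed.

Lemma spec_projI A B u x : measurable A -> measurable B ->
  h (spec_proj E (A `&` B) u) x = h (spec_proj E A (spec_proj E B u)) x.
Proof.
by move=> mA mB; exact: null_ipl ((L2eqP _ _).1 (spec_setI E u mA mB)).
Qed.

Definition L2_family : spectral_family (measurableTypeR R) h :=
  @SpectralFamily _ (measurableTypeR R) R _ h (spec_proj E) (spec_meas E)
    spec_proj_linear (fun A u v mA => spec_sym E u v mA) spec_projT spec_projI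
    (fun u A mA => spec_measE E u mA).
Local Notation S := L2_family.

Lemma spectral_int_calc (phi : measurableTypeR R -> R) u w :
  measurable_fun setT phi ->
  spectral_int (spec_meas E) phi u w <-> calc S phi u w.
Proof.
move=> mphi.
have domP v : (\int[spec_meas E v]_l ((phi l) ^+ 2)%:E < +oo)%E <->
    phi \in Lfun (smeas S v) 2%:E.
  by split; [exact: Lfun2P|exact: Lfun2_sqr_lty].
split=> [[/domP u2 uw]|cw].
  by apply: calc_of_polar => // v /domP; exact: uw.
by split; [exact/domP/cw.1|move=> v /domP; exact: calc_polar].
Qed.

Lemma laplacian_calc u w : laplacian_graph u w <-> calc S id u w.
Proof.
by apply: (iff_trans (spec_opL E u w)); apply: spectral_int_calc.
Qed.

(** [(L u, u)] is the Dirichlet integral of [u]. *)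
Lemma laplacian_ge0 u w : calc S id u w -> 0 <= h w u.
Proof.
move=> /laplacian_calc[ux [uy [uH /(_ _ _ _ uH) wu]]].
by rewrite /= -wu addr_ge0 ?L2inner_ge0.
Qed.

Definition laplacian_operator : energy_operator h :=
  spectral_energy_operator laplacian_ge0.
Local Notation A := laplacian_operator.

(** The power function and the square root differ on the negative half line only,
    which carries no mass. *)
Lemma powL_half_calc u w : powL_graph E 2^-1 u w <-> calc S Num.sqrt u w.
Proof.
have mpow : measurable_fun setT (fun l : measurableTypeR R => (l : R) `^ 2^-1).
  exact: measurable_powR.
apply: (iff_trans (spectral_int_calc u w mpow)).
have ae12 : {ae smeas S u, forall x : measurableTypeR R,
    (x : R) `^ 2^-1 = Num.sqrt (x : R)}.
  by apply: filterS (smeas_ae_ge0 laplacian_ge0 u) => x /powR12_sqrt.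
split=> cw; first by apply: (calc_ae cw) => //; exact: sqrt_measurable.
by apply: (calc_ae cw) => //; apply: filterS ae12.
Qed.

Lemma in_DhalfP u : in_Dhalf E u <-> hd A u.
Proof.
split=> [[w /powL_half_calc[]//]|/calc_exists[w cw]].
by exists w; apply/powL_half_calc.
Qed.

Lemma energy_normE u : hd A u -> energy_norm E u = en A u.
Proof.
move=> /in_DhalfP uh; rewrite /energy_norm L2normE.
have /powL_half_calc cw : powL_graph E 2^-1 u (powL E 2^-1 u).
  by have [w uw] := uh; apply: (xgetPex 0 (P := [set w | powL_graph E 2^-1 u w])); exists w.
exact/esym/(energy_nrm cw).
Qed.

Lemma in_DL_gr u : in_DL u -> gr A u (opL u).
Proof.
move=> [g ug]; apply/laplacian_calc.
by apply: (xgetPex 0 (P := [set g | laplacian_graph u g])); exists g.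
Qed.

Lemma gr_in_DL u w : gr A u w -> in_DL u.
Proof. by move=> /laplacian_calc uw; exists w. Qed.

End laplacian_calculus.

(** * Bounds on the data *)

Section data_bounds.
Context (R : realType) (T : R).
Hypothesis T0 : 0 < T.

Lemma C1_on_continuous (k : R -> R) : C1_on T k ->
  {within `[0, T], continuous k}.
Proof.
move=> [dk [_ kd]]; apply/subspace_continuousP => t tT.
apply/cvgrPdist_le => e e0; rewrite near_withinE.
have D0 : 0 < `|dk t| + 1 by rewrite ltr_wpDl.
have /cvgrPdist_le/(_ _ (divr_gt0 e0 D0)) N1 : id s @[s --> t] --> t.
  exact: cvg_id.
have /cvgrPdist_le/(_ 1 ltr01) := kd t tT; rewrite near_withinE => N2.
apply: filterS2 N1 N2 => s st dst sT.
have [->|st0] := eqVneq s t; first by rewrite subrr normr0 ltW.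
have st1 : s - t != 0 by rewrite subr_eq0.
have {}dst := dst (conj sT (elimN eqP st0)).
rewrite distrC -[k s - k t](divfK st1) normrM.
apply: (@le_trans _ _ ((`|dk t| + 1) * (e / (`|dk t| + 1)))).
  apply: ler_pM => //; last by rewrite distrC.
  rewrite -lerBlDl; apply: le_trans dst; rewrite distrC.
  exact: le_trans (lerB_dist _ _).
by rewrite mulrCA divff ?mulr1// gt_eqF.
Qed.

Lemma min_on_le (k : R -> R) t : C1_on T k -> t \in `[0, T] -> min_on T k <= k t.
Proof.
move=> /C1_on_continuous ck tT; have [c cT kc] := EVT_min (ltW T0) ck.
apply: ge_inf; last by exists t.
by exists (k c) => _ [s sT <-]; exact: kc.
Qed.

Lemma max_on_ge (k : R -> R) t : C1_on T k -> t \in `[0, T] -> k t <= max_on T k.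
Proof.
move=> /C1_on_continuous ck tT; have [c cT kc] := EVT_max (ltW T0) ck.
apply: sup_upper_bound; last by exists t.
split; first by exists (k t), t.
by exists (k c) => _ [s sT <-]; exact: kc.
Qed.

Lemma tgrid_in n k : (0 < n)%N -> (k <= n)%N -> tgrid T n k \in `[0, T].
Proof.
move=> n0 kn; rewrite in_itv /= /tgrid /tstep; apply/andP; split.
  by rewrite mulr_ge0// divr_ge0// ltW.
by rewrite mulrCA ler_piMr ?(ltW T0)// ler_pdivrMr ?ltr0n// mul1r ler_nat.
Qed.

Context (Om : bounded_convex_domain R) (f : R -> L2 Om).

Lemma L2norm_fmax n k : (1 <= k <= n)%N ->
  L2norm (f (tgrid T n k)) <= fmax T f n.
Proof.
move=> /andP[k1 kn]; rewrite /fmax.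
apply: (@le_bigmax_seq _ R _ _ _ _ xpredT (fun i => L2norm (f (tgrid T n i)))) => //.
by rewrite mem_index_iota k1 ltnS.
Qed.

Lemma fmax_ge0 n : 0 <= fmax T f n.
Proof.
by rewrite /fmax; elim/big_ind: _ => // [x y x0 y0|i _];
  [rewrite le_max x0|rewrite L2normE nrm_ge0].
Qed.

Lemma fmax_bounded : L2continuous T f ->
  exists2 B, 0 <= B & forall n, (0 < n)%N -> fmax T f n <= B.
Proof.
move=> fc.
have nc : {within `[0, T], continuous (fun t => L2norm (f t))}.
  apply/subspace_continuousP => t tT; apply/cvgrPdist_le => e e0.
  have /cvgrPdist_le/(_ e e0) := fc t tT.
  apply: filterS => s; rewrite sub0r normrN !L2normE.
  rewrite ger0_norm ?nrm_ge0//; apply: le_trans.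
  have := nrm_tri (L2_form Om) (f s) (f t) 0.
  have := nrm_tri (L2_form Om) (f t) (f s) 0.
  rewrite !subr0 (nrmBC _ (f t)) => ? ?.
  suff H : `|L2norm (f t) - L2norm (f s)| <= nrm (L2_form Om) (f s - f t).
    exact: H.
  by rewrite ler_norml !L2normE; lra.
have [c cT fle] := EVT_max (ltW T0) nc.
exists (L2norm (f c)); first by rewrite L2normE nrm_ge0.
move=> n n0; rewrite /fmax big_seq.
apply: bigmax_le => [|i]; first by rewrite L2normE nrm_ge0.
by rewrite mem_index_iota => /andP[_ i_n]; apply: fle; exact: tgrid_in.
Qed.

End data_bounds.

(** * Solvability and convergence at one time level *)

Section one_level.
Context (R : realType) (Om : bounded_convex_domain R).
Variables (E : spectral_resolution Om) (T : R) (alpha beta : R -> R).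
Variable f : R -> L2 Om.
Local Notation h := (L2_form Om).
Local Notation A := (laplacian_operator E).

Lemma level_eqP n k (uk um x v : L2 Om) : hd A um -> hd A x ->
  level_eq E T alpha beta f n k uk um x v <->
  step_eq A (tstep T n) (alpha (tgrid T n k)) (beta (tgrid T n k)) um uk
    (f (tgrid T n k)) x v.
Proof.
move=> hm hx; have hxm : hd A (2 *: x - um) by apply: hd_sub => //; exact: hdZ.
rewrite /level_eq /step_eq /kcoef !energy_normE// -/(step_coef _ _ _ _ _).
split=> [[/in_DL_gr vy /L2eqP vg]|[y vy vg]]; first by exists (opL v).
split; first exact: gr_in_DL vy.
apply/L2eqP/nullP => z; have := null_ip z vg.
have /null_ip-/(_ z) := gr_unique (in_DL_gr E (gr_in_DL vy)) vy.
by rewrite !ipE => /eqP; rewrite subr_eq0 => /eqP ->.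
Qed.

Lemma L2eq_refl (v : L2 Om) : v =L2 v.
Proof. exact/nearW. Qed.

Lemma iteration_exists n k (uk um : L2 Om) : hd A um -> hd A uk ->
  (forall x, exists v, step_eq A (tstep T n) (alpha (tgrid T n k))
     (beta (tgrid T n k)) um uk (f (tgrid T n k)) x v) ->
  exists vl, iteration E T alpha beta f n k uk um vl.
Proof.
move=> hm hk /choice[G HG]; pose vl l := iter l G (2^-1 *: (uk + um)).
exists vl; split; first exact: L2eq_refl.
move=> l; apply/(level_eqP _ _ _ _ hm); last exact: HG.
by case: l => [|l]; [apply: hdZ; exact: hdD|exact: step_eq_hd (HG _)].
Qed.

Lemma tau0_ge (M2 M4 : R) : 0 < T -> C1_on T beta ->
  0 < min_on T alpha -> 0 < min_on T beta -> L2continuous T f ->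
  0 < M2 -> 0 < M4 ->
  exists2 taubar : R, 0 < taubar &
    forall n : nat, (1 < n)%N -> taubar <= tau0 T alpha beta f M2 M4 n.
Proof.
move=> T0 cb am0 bm0 fc M20 M40.
have [B B0 fB] := fmax_bounded T0 fc.
have T_in : 0 \in `[0, T] by rewrite in_itv /= lexx ltW.
have bM0 : 0 < max_on T beta.
  by apply: lt_le_trans bm0 (le_trans (min_on_le T0 cb T_in) (max_on_ge T0 cb T_in)).
pose c := T / (2 * Num.sqrt (2 * min_on T alpha)).
pose c' := (Num.sqrt (2 * min_on T alpha))^-1.
pose K x := (M2 + 2 * (c * x + M2)) * (c' * ((min_on T alpha)^-1 * x + M4))
            * max_on T beta.
have c0 : 0 <= c by rewrite divr_ge0 ?mulr_ge0 ?sqrtr_ge0 ?(ltW T0).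
have c'0 : 0 < c' by rewrite invr_gt0 sqrtr_gt0 mulr_gt0.
have am1 : 0 <= (min_on T alpha)^-1 by rewrite invr_ge0 ltW.
have Kgt0 x : 0 <= x -> 0 < K x.
  move=> x0; have := mulr_ge0 c0 x0; have := mulr_ge0 am1 x0 => x1 x2.
  by rewrite /K !mulr_gt0//; lra.
have K_le x y : 0 <= x -> x <= y -> K x <= K y.
  move=> x0 xy; have := mulr_ge0 c0 x0; have := mulr_ge0 am1 x0 => x1 x2.
  have y1 := ler_wpM2l c0 xy; have y2 := ler_wpM2l am1 xy.
  rewrite /K ler_wpM2r ?(ltW bM0)// ler_pM//; [lra|..|lra|].
  - by rewrite mulr_ge0 ?(ltW c'0)//; lra.
  - by rewrite ler_wpM2l ?(ltW c'0)//; lra.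
exists (K B)^-1; first by rewrite invr_gt0 Kgt0.
move=> n n1; rewrite -[tau0 _ _ _ _ _ _ _]/((K (fmax T f n))^-1).
have F0 := fmax_ge0 T f n.
by rewrite lef_pV2 ?posrE ?Kgt0// K_le// fB// ltnW.
Qed.

End one_level.

Unset Implicit Arguments.

Theorem theorem5p1 (R : realType) (Om : bounded_convex_domain R)
    (E : spectral_resolution Om) (T : R) (alpha beta : R -> R)
    (f : R -> L2 Om) (u0 v0 : L2 Om) (M2 M4 : R) :
  0 < T ->
  C1_on T alpha -> C1_on T beta ->
  0 < min_on T alpha -> 0 < min_on T beta ->
  L2continuous T f ->
  apriori_M2 E T alpha beta f u0 v0 M2 ->
  apriori_M4 E T alpha beta f u0 v0 M4 ->
  (exists2 taubar : R, 0 < taubar &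
    forall n : nat, (1 < n)%N -> taubar <= tau0 T alpha beta f M2 M4 n) /\
  forall (n k : nat) (u : nat -> L2 Om),
    (1 < n)%N -> (1 <= k <= n.-1)%N ->
    scheme_upto E T alpha beta f u0 v0 n k u ->
    Dhalf_bound E (u k.-1) M2 -> Dhalf_bound E (u k) M2 ->
    DL_bound (u k) M4 ->
    let tau := tstep T n in
    let rho := tau / tau0 T alpha beta f M2 M4 n in
    tau < tau0 T alpha beta f M2 M4 n ->
    exists v : L2 Om,
      [/\ nonlinear_solution E T alpha beta f n k (u k) (u k.-1) v,
          forall v' : L2 Om,
            nonlinear_solution E T alpha beta f n k (u k) (u k.-1) v' ->
            v' =L2 v,
          exists vl : nat -> L2 Om,
            iteration E T alpha beta f n k (u k) (u k.-1) vl,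
          rho < 1
        & forall vl : nat -> L2 Om,
            iteration E T alpha beta f n k (u k) (u k.-1) vl ->
            [/\ forall l, in_Dhalf E (v - vl l),
                forall l, energy_norm E (v - vl l.+1)
                          <= rho * energy_norm E (v - vl l)
              & energy_norm E (v - vl l) @[l --> \oo] --> (0 : R)]].
Proof.
move=> T0 Ca Cb am0 bm0 fc [M20 _] [M40 _].
split; first exact: tau0_ge.
move=> n k u n1 /andP[k1 kn] _ [/in_DhalfP um_hd um_en] [/in_DhalfP uk_hd uk_en].
move=> [/(in_DL_gr E) uk_gr uk_op] tau rho tau_lt.
set um := u k.-1 in um_hd um_en *; set uk := u k in uk_hd uk_en uk_gr uk_op *.
have n0 : (0 < n)%N by exact: ltnW.
have kn' : (k <= n)%N by apply: leq_trans kn _; exact: leq_pred.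
have tk := tgrid_in T0 n0 kn'.
pose A := laplacian_operator E.
rewrite (energy_normE um_hd) in um_en; rewrite (energy_normE uk_hd) in uk_en.
have tau_gt0 : 0 < tau by rewrite divr_gt0 ?ltr0n.
have tau_le : tau <= T.
  by rewrite /tau /tstep ler_pdivrMr ?ltr0n// ler_peMr ?(ltW T0)// ler1n.
have al_ge := min_on_le T0 Ca tk.
have be_ge0 : 0 <= beta (tgrid T n k).
  exact: le_trans (ltW bm0) (min_on_le T0 Cb tk).
have be_le := max_on_ge T0 Cb tk.
rewrite L2normE in uk_op.
have F_le : nrm (L2_form Om) (f (tgrid T n k)) <= fmax T f n.
  by rewrite -L2normE L2norm_fmax// k1.
have c_ge0 : 0 <= tau / (2 * Num.sqrt (2 * min_on T alpha)).
  by apply: divr_ge0; [exact: ltW|rewrite mulr_ge0 ?sqrtr_ge0].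
have K5_ge : tau / (2 * Num.sqrt (2 * min_on T alpha)) *
    nrm (L2_form Om) (f (tgrid T n k)) + M2 <= M5 T alpha f M2 n.
  rewrite /M5 lerD2r ler_pM ?nrm_ge0//.
  by rewrite ler_wpM2r ?invr_ge0 ?mulr_ge0 ?sqrtr_ge0.
have K6_ge : (Num.sqrt (2 * min_on T alpha))^-1 * ((min_on T alpha)^-1 *
    nrm (L2_form Om) (f (tgrid T n k)) + M4) <= M6 T alpha f M4 n.
  rewrite /M6 ler_wpM2l ?invr_ge0 ?sqrtr_ge0// lerD2r.
  by rewrite ler_wpM2l// invr_ge0 ltW.
have rhoE : rho = tau * (M7 T alpha f M2 n * M6 T alpha f M4 n * max_on T beta).
  by rewrite /rho /tau0 invrK.
have rho0 : 0 <= rho.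
  by rewrite divr_ge0 ?(ltW tau_gt0)// ltW// (lt_trans tau_gt0).
have rho1 : rho < 1.
  by rewrite /rho ltr_pdivrMr ?mul1r// (lt_trans tau_gt0).
have rho1' : tau * ((M2 + 2 * M5 T alpha f M2 n) * M6 T alpha f M4 n *
    max_on T beta) < 1 by rewrite -[X in X < 1]rhoE.
have vK := step_eq_trial tau_gt0 am0 al_ge be_ge0 um_hd um_en uk_gr uk_en K5_ge.
have contr := step_contraction tau_gt0 am0 al_ge be_ge0 be_le um_hd um_en uk_gr
  uk_op K5_ge K6_ge.
have uniq_v := step_unique tau_gt0 am0 al_ge be_ge0 be_le um_hd um_en uk_gr
  uk_en uk_op K5_ge K6_ge.
have [v vv] : exists v, step_eq A tau (alpha (tgrid T n k)) (beta (tgrid T n k))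
    um uk (f (tgrid T n k)) v v.
  exact: (step_exists tau_gt0 am0 al_ge be_ge0 be_le um_hd um_en uk_gr uk_en
    uk_op K5_ge K6_ge rho1').
have hv := step_eq_hd vv.
have mean_hd : hd A (2^-1 *: (uk + um)) by apply: hdZ; exact: hdD.
have iter_hd vl : iteration E T alpha beta f n k uk um vl ->
    forall l, hd A (vl l).
  move=> [v0E vlE] [|l].
    by have [] := hd_null mean_hd (nullC ((L2eqP _ _).1 v0E)).
  by have [/(in_DL_gr E)/gr_hd[]] := vlE l.
have iterE vl : iteration E T alpha beta f n k uk um vl -> forall l,
    step_eq A tau (alpha (tgrid T n k)) (beta (tgrid T n k)) um uk
      (f (tgrid T n k)) (vl l) (vl l.+1).
  by move=> vlI l; apply/level_eqP => //; [exact: iter_hd|have [_] := vlI].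
have iter_en vl : iteration E T alpha beta f n k uk um vl ->
    forall l, en A (2 *: vl l - um) <= M7 T alpha f M2 n.
  move=> vlI [|l]; last exact: vK (iterE _ vlI l).
  have [/L2eqP v0E _] := vlI.
  have e0 : null (L2_form Om) (uk - (2 *: vl 0%N - um)).
    by apply: nullP => z; have := null_ip z v0E; rewrite !ipE; lra.
  have [_ ->] := hd_null uk_hd e0.
  apply: le_trans uk_en _; rewrite lerDl mulr_ge0//.
  by apply: le_trans K5_ge; rewrite addr_ge0 ?(ltW M20)// mulr_ge0 ?nrm_ge0.
have step_le vl : iteration E T alpha beta f n k uk um vl -> forall l,
    energy_norm E (v - vl l.+1) <= rho * energy_norm E (v - vl l).
  move=> vlI l; rewrite !energy_normE ?rhoE;
    [|exact: hd_sub hv (iter_hd _ vlI _)|exact: hd_sub hv (iter_hd _ vlI _)].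
  exact: (contr _ _ _ _ hv (iter_hd _ vlI l) (vK _ _ vv) (iter_en _ vlI l) vv
    (iterE _ vlI l)).
exists v; split.
- exact/level_eqP.
- move=> v' v'v'; have hv' : hd A v'.
    by have [/(in_DL_gr E)/gr_hd[]] := v'v'.
  have v'v'' : step_eq A tau (alpha (tgrid T n k)) (beta (tgrid T n k)) um uk
      (f (tgrid T n k)) v' v' by exact/level_eqP.
  by apply/L2eqP; exact: uniq_v rho1' v'v'' vv.
- apply: (iteration_exists um_hd uk_hd) => x.
  exact: step_eq_solvable tau_gt0 am0 al_ge be_ge0 x.
- exact: rho1.
move=> vl vlI; split=> [l|l|].
- by apply/in_DhalfP; apply: hd_sub => //; exact: iter_hd.
- exact: step_le.
have le_geo l : energy_norm E (v - vl l) <= energy_norm E (v - vl 0%N) * rho ^+ l.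
  elim: l => [|l ih]; first by rewrite expr0 mulr1.
  apply: le_trans (step_le _ vlI l) _; rewrite exprS mulrCA ler_wpM2l//.
have geo0 : energy_norm E (v - vl 0%N) * rho ^+ l @[l --> \oo] --> (0 : R).
  by rewrite -(mulr0 (energy_norm E (v - vl 0%N))); apply: cvgM;
    [exact: cvg_cst|apply: cvg_expr; rewrite ger0_norm].
apply: (squeeze_cvgr _ (cvg_cst 0) geo0).
by apply: nearW => l; rewrite le_geo andbT /energy_norm L2normE nrm_ge0.
Qed.
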